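(* Let $\lambda_0\in\mathbb D\setminus\{0\}$ and let $x=(a,b,p)\in\mathbb E$, where $\mathbb E$ is the tetrablock. Then the following conditions are equivalent: $(1)$ there exists an analytic function $\varphi:\mathbb D\to\overline{\mathbb E}$ such that $\varphi(0)=(0,0,0)$ and $\varphi(\lambda_0)=x$; $(1')$ there exists an analytic function $\varphi:\mathbb D\to\mathbb E$ such that $\varphi(0)=(0,0,0)$ and $\varphi(\lambda_0)=x$; $(2)$ $$\max\left\{\frac{|a-\bar b p|+|ab-p|}{1-|b|^2},\ \frac{|b-\bar a p|+|ab-p|}{1-|a|^2}\right\}\le|\lambda_0|;$$ $(3)$ either $|b|\le|a|$ and $$\frac{|a-\bar b p|+|ab-p|}{1-|b|^2}\le|\lambda_0|,$$ or $|a|\le|b|$ and $$\frac{|b-\bar a p|+|ab-p|}{1-|a|^2}\le|\lambda_0|;$$ $(4)$ there exists a $2\times2$ matrix-valued function $F$ in the Schur class such that $F(0)=\begin{bmatrix}0&*\\0&0\end{bmatrix}$ and $F(\lambda_0)=A=[a_{ij}]$, where $x=(a_{11},a_{22},\det A)$; $(5)$ either $|b|\le|a|$ and $\|\Psi(\cdot,x)\|_{H^\infty}\le|\lambda_0|$, or $|a|\le|b|$ and $\|\Upsilon(\cdot,x)\|_{H^\infty}\le|\lambda_0|$; $(6)$ either $|b|\le|a|$ and $$|a|^2-|\lambda_0|^2|b|^2+|p|^2+2\big||\lambda_0|^2b-\bar a p\big|\le|\lambda_0|^2,$$ or $|a|\le|b|$ and $$|b|^2-|\lambda_0|^2|a|^2+|p|^2+2\big||\lambda_0|^2a-\bar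 b p\big|\le|\lambda_0|^2;$$ $(7)$ either $|b|\le|a|$ and $\lambda_0-az-b\lambda_0w+pzw\ne0$ for all $z,w\in\mathbb D$, or $|a|\le|b|$ and $\lambda_0-a\lambda_0z-bw+pzw\ne0$ for all $z,w\in\mathbb D$; $(8)$ either $|b|\le|a|$ and $$|\lambda_0||a-\bar b p|+\big||\lambda_0|^2b-\bar a p\big|+|p|^2\le|\lambda_0|^2,$$ or $|a|\le|b|$ and $$|\lambda_0||b-\bar a p|+\big||\lambda_0|^2a-\bar b p\big|+|p|^2\le|\lambda_0|^2;$$ $(9)$ either $|b|\le|a|$, $|p|\le|\lambda_0|$ and $$|a|^2+|\lambda_0b|^2-|p|^2+2|\lambda_0||ab-p|\le|\lambda_0|^2,$$ or $|a|\le|b|$, $|p|\le|\lambda_0|$ and $$|b|^2+|\lambda_0a|^2-|p|^2+2|\lambda_0||ab-p|\le|\lambda_0|^2;$$ $(10)$ either $|b|\le|a|$, $|p|\le|\lambda_0|$ and there exist $\beta_1,\beta_2\in\mathbb C$ with $|\beta_1|+|\beta_2|\le1$ such that $$a=\beta_1\lambda_0+\bar\beta_2p\quad\text{and}\quad b\lambda_0=\beta_2\lambda_0+\bar\beta_1p,$$ or $|a|\le|b|$, $|p|\le|\lambda_0|$ and there exist $\beta_1,\beta_2\in\mathbb C$ with $|\beta_1|+|\beta_2|\le1$ such that $$a\lambda_0=\beta_1\lambda_0+\bar\beta_2p\quad\text{and}\quad b=\beta_2\lambda_0+\bar\beta_1p.$$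
   Context: $\mathbb D$ is the open unit disc in $\mathbb C$ and $\overline{\mathbb D}$ its closure. The tetrablock is $$\mathbb E=\{(x_1,x_2,x_3)\in\mathbb C^3: 1-zx_1-wx_2+zwx_3\ne0\ \text{for all } z,w\in\overline{\mathbb D}\},$$ and $\overline{\mathbb E}$ is its closure in $\mathbb C^3$. An analytic function $\mathbb D\to\overline{\mathbb E}$ is an analytic map $\mathbb D\to\mathbb C^3$ with values in $\overline{\mathbb E}$. For $z\in\mathbb C$ and $x=(x_1,x_2,x_3)\in\mathbb C^3$, $$\Psi(z,x)=\frac{x_3z-x_1}{x_2z-1},\qquad \Upsilon(z,x)=\Psi(z,(x_2,x_1,x_3))=\frac{x_3z-x_2}{x_1z-1},$$ where $\Psi(\cdot,x)$ is interpreted as the constant function $x_1$ (and $\Upsilon(\cdot,x)$ as the constant function $x_2$) when $x_1x_2=x_3$. $\|\cdot\|_{H^\infty}$ denotes the supremum of the modulus over $\mathbb D$. The $2\times2$ Schur class is the set of analytic functions $F$ from $\mathbb D$ to the $2\times2$ complex matrices with operator norm $\|F(z)\|\le1$ for all $z\in\mathbb D$. The symbol $*$ in a matrix denotes an arbitrary (unspecified) complex entry. All ''either ... or'' are inclusive. *)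

(* Defs.v *)
From Stdlib Require Export Reals List.
From Coquelicot Require Export Coquelicot.
Export ListNotations.
Open Scope R_scope.

Definition unit_disc (z : C) : Prop := Cmod z < 1.
Definition closed_unit_disc (z : C) : Prop := Cmod z <= 1.

Definition tetrablock (x : C * C * C) : Prop :=
  let '(x1, x2, x3) := x in
  forall z w : C, closed_unit_disc z -> closed_unit_disc w ->
    (1 - z * x1 - w * x2 + z * w * x3)%C <> 0%C.

Definition closure {T : UniformSpace} (S : T -> Prop) (x : T) : Prop :=
  forall V : T -> Prop, locally x V -> exists y : T, V y /\ S y.

(** Complex differentiability at every point of the open unit disc; the values of
    [f] off the disc play no role since the disc is open. *)
Definition analytic_on_disc {V : NormedModule C_AbsRing} (f : C -> V) : Prop :=
  forall z : C, unit_disc z -> @ex_derive C_AbsRing V f z.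

(** The equality test encodes the convention that [Psi _ x] is the constant
    [x1] when [x1 x2 = x3], where the quotient reduces to [x1] away from its
    possible pole. *)
Definition Psi (z : C) (x : C * C * C) : C :=
  let '(x1, x2, x3) := x in
  if Ceq_dec (x1 * x2)%C x3 then x1 else ((x3 * z - x1) / (x2 * z - 1))%C.

Definition Upsilon (z : C) (x : C * C * C) : C :=
  let '(x1, x2, x3) := x in Psi z (x2, x1, x3).

Definition Hinf_norm (f : C -> C) : Rbar :=
  Lub_Rbar (fun r : R => exists z : C, unit_disc z /\ r = Cmod (f z)).

Definition entry {m n : nat} (A : @matrix C m n) (i j : nat) : C :=
  coeff_mat (RtoC 0) A i j.

Definition det2 (A : @matrix C 2 2) : C :=
  (entry A 0 0 * entry A 1 1 - entry A 0 1 * entry A 1 0)%C.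

Definition vec_norm (v : @matrix C 2 1) : R :=
  sqrt (Cmod (entry v 0 0) ^ 2 + Cmod (entry v 1 0) ^ 2).

Definition op_norm (A : @matrix C 2 2) : Rbar :=
  Lub_Rbar (fun r : R => exists v : @matrix C 2 1,
    vec_norm v <= 1 /\ r = vec_norm (@Mmult C_Ring 2 2 1 A v)).

Definition schur_class (F : C -> @matrix C 2 2) : Prop :=
  (forall i j : nat, (i < 2)%nat -> (j < 2)%nat ->
     analytic_on_disc (fun z : C => entry (F z) i j)) /\
  (forall z : C, unit_disc z -> Rbar_le (op_norm (F z)) 1).

(* Main.v *)
Require Import Defs.
From Stdlib Require Import Lra Lia Classical ClassicalEpsilon.

(** All conditions (2), (3), (5)-(10) are rewritten as the single inequality
    [|p z - a| <= |lambda0| |b z - 1|] on the disc or its mirror image under [a <-> b].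
    After dividing [a] and [p] by [lambda0] this says that [Psi(., x)] is bounded by [1], and
    the various closed forms follow by elementary algebra from the identity
    [|x1 - x2^* x3|^2 - |x1 x2 - x3|^2 = (1 - |x2|^2) (|x1|^2 - |x3|^2)] and its variants.

    Necessity: both inequalities come from Schwarz's lemma applied to [t |-> Psi(z, phi t)] for
    fixed [z]. Schwarz's lemma itself rests on Goursat's theorem for rectangles, used in
    logarithmic coordinates, where it gives the mean value property at once.

    Sufficiency: write [(a / lambda0, b, p / lambda0)] as
    [(b1 + b2^* x3, b2 + b1^* x3, x3)] with [|b1| + |b2| <= 1]. Keeping [b1, b2] fixed and
    replacing [x3] by a disc map [psi] stays in the closed tetrablock, and [|b| <= |a|] is
    precisely what allows a Moebius [psi] with [b2 + b1^* psi(0) = 0] and [psi(lambda0) = x3].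
    Multiplying the first and third coordinates by [z] gives [phi]. The Schur function is
    obtained in the same way from a matrix [U diag(1, psi) V] with constant unitary [U], [V]
    whose diagonal is [(b1 + b2^* psi, b2 + b1^* psi)]. *)

(** * Complex differentiability *)

(** The two inequalities in (2) are never compared by algebra. A one-sided statement, an inequality
    for the larger of [|a|], [|b|], is the hub: from it a map into the open tetrablock is built, and
    Schwarz's lemma applied to that map returns both inequalities, whatever the order of [|a|] and
    [|b|]. So the one-sided inequality implies its mirror image only by way of an analytic map.

    The closed forms themselves do not involve that order. They are linked by (6) to (9) to (3) to
    the disc inequality and back to (6), with (8) tied to (6). Each comparison is a squared
    inequality that collapses by one of the modulus identities; the only difficulty is the sign of
    the quantity whose square is taken, and there the triangle bounds on the moduli and [|b| < 1]
    enter.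

    Only [a] and [p] are divided by [lambda0] because the numerator [x3 z - x1] of [Psi] is linear
    in these two coordinates, while [b] sits in the denominator. In the construction, the factor [z]
    put on the same two coordinates turns the weak inequality into the strict one that defines the
    open tetrablock. *)

Definition C_diff (f : C -> C) (z l : C) : Prop :=
  forall eps : R, 0 < eps -> exists d : R, 0 < d /\
    forall w : C, Cmod (w - z)%C < d ->
      Cmod (f w - f z - l * (w - z))%C <= eps * Cmod (w - z)%C.

Lemma C_diff_of_is_derive (f : C -> C) (z l : C) :
  @is_derive C_AbsRing C_NormedModule f z l -> C_diff f z l.
Proof.
  intros [_ H] eps Heps.
  destruct (H z (fun P HP => HP) (mkposreal eps Heps)) as [d Hd].
  exists d; split; [apply cond_pos|].
  intros w Hw.
  generalize (Hd w Hw); cbn -[Cmod].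
  unfold minus, plus, opp, scal; cbn -[Cmod]; unfold mult; cbn -[Cmod].
  intros K.
  replace (f w - f z - l * (w - z))%C
    with (f w + - f z + - ((w + - z) * l))%C by ring.
  exact K.
Qed.

Lemma is_derive_of_C_diff (f : C -> C) (z l : C) :
  C_diff f z l -> @is_derive C_AbsRing C_NormedModule f z l.
Proof.
  intros H; split; [apply (@is_linear_scal_l C_AbsRing C_NormedModule)|].
  intros x Hx.
  (* The domination clause of [filterdiff] ranges over every limit [x] of the filter; uniqueness of
     limits identifies it with [z]. *)
  assert (Ex : z = x).
  { apply (@is_filter_lim_locally_unique C_AbsRing (AbsRing_NormedModule C_AbsRing)).
    exact Hx. }
  subst x; intros eps.
  destruct (H eps (cond_pos eps)) as (d & Hd & K).
  exists (mkposreal d Hd); intros w Hw.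
  generalize (K w Hw); cbn -[Cmod].
  unfold minus, plus, opp, scal; cbn -[Cmod]; unfold mult; cbn -[Cmod].
  intros K'.
  replace (f w + - f z + - ((w + - z) * l))%C
    with (f w - f z - l * (w - z))%C by ring.
  exact K'.
Qed.

Definition C_differentiable (f : C -> C) (z : C) : Prop := exists l, C_diff f z l.

Lemma C_differentiable_iff (f : C -> C) (z : C) :
  @ex_derive C_AbsRing C_NormedModule f z <-> C_differentiable f z.
Proof.
  split; intros [l Hl]; exists l.
  - now apply C_diff_of_is_derive.
  - now apply is_derive_of_C_diff.
Qed.

Lemma Cmod_minus_sym (z w : C) : Cmod (z - w)%C = Cmod (w - z)%C.
Proof. rewrite <- Cmod_opp; f_equal; ring. Qed.

Lemma Cmod_triangle_minus (z w : C) : Cmod (z - w)%C <= Cmod z + Cmod w.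
Proof. unfold Cminus; rewrite <- (Cmod_opp w); apply Cmod_triangle. Qed.

Lemma Cmod_triangle_rev (z w : C) : Cmod z - Cmod w <= Cmod (z - w)%C.
Proof.
  generalize (Cmod_triangle (z - w) w).
  replace (z - w + w)%C with z by ring; lra.
Qed.

Lemma C_diff_cont (f : C -> C) (z l : C) : C_diff f z l ->
  forall eps : R, 0 < eps -> exists d : R, 0 < d /\
    forall w : C, Cmod (w - z)%C < d -> Cmod (f w - f z)%C < eps.
Proof.
  intros H eps Heps.
  destruct (H 1 Rlt_0_1) as (d & Hd & K).
  pose proof (Cmod_ge_0 l) as Hl.
  exists (Rmin d (eps / (Cmod l + 1))); split.
  { apply Rmin_pos; auto; apply Rdiv_lt_0_compat; lra. }
  intros w Hw.
  assert (H1 : Cmod (w - z)%C < d) by (eapply Rlt_le_trans; [exact Hw | apply Rmin_l]).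
  assert (H2 : Cmod (w - z)%C < eps / (Cmod l + 1))
    by (eapply Rlt_le_trans; [exact Hw | apply Rmin_r]).
  apply Rlt_div_r in H2; [|lra].
  generalize (K w H1); intros K1.
  generalize (Cmod_triangle (f w - f z - l * (w - z)) (l * (w - z))).
  replace (f w - f z - l * (w - z) + l * (w - z))%C with (f w - f z)%C by ring.
  rewrite Cmod_mult; nra.
Qed.

Lemma C_diff_const (c z : C) : C_diff (fun _ => c) z 0%C.
Proof.
  intros eps Heps; exists 1; split; [lra|]; intros w _.
  replace (c - c - 0 * (w - z))%C with (RtoC 0) by ring.
  rewrite Cmod_0; apply Rmult_le_pos; [lra | apply Cmod_ge_0].
Qed.

Lemma C_diff_id (z : C) : C_diff (fun w => w) z 1%C.
Proof.
  intros eps Heps; exists 1; split; [lra|]; intros w _.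
  replace (w - z - 1 * (w - z))%C with (RtoC 0) by ring.
  rewrite Cmod_0; apply Rmult_le_pos; [lra | apply Cmod_ge_0].
Qed.

Lemma C_diff_plus (f g : C -> C) (z l m : C) :
  C_diff f z l -> C_diff g z m -> C_diff (fun w => f w + g w)%C z (l + m)%C.
Proof.
  intros Hf Hg eps Heps.
  destruct (Hf (eps / 2)) as (d1 & Hd1 & K1); [lra|].
  destruct (Hg (eps / 2)) as (d2 & Hd2 & K2); [lra|].
  exists (Rmin d1 d2); split; [now apply Rmin_pos|]; intros w Hw.
  assert (H1 := K1 w (Rlt_le_trans _ _ _ Hw (Rmin_l _ _))).
  assert (H2 := K2 w (Rlt_le_trans _ _ _ Hw (Rmin_r _ _))).
  replace (f w + g w - (f z + g z) - (l + m) * (w - z))%C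
    with ((f w - f z - l * (w - z)) + (g w - g z - m * (w - z)))%C by ring.
  eapply Rle_trans; [apply Cmod_triangle | lra].
Qed.

Lemma C_diff_mult (f g : C -> C) (z l m : C) :
  C_diff f z l -> C_diff g z m ->
  C_diff (fun w => f w * g w)%C z (l * g z + f z * m)%C.
Proof.
  intros Hf Hg eps Heps.
  pose proof (Cmod_ge_0 l) as Hl0.
  pose proof (Cmod_ge_0 (f z)) as Hf0.
  pose proof (Cmod_ge_0 (g z)) as Hg0.
  set (M := Cmod l + Cmod (f z) + Cmod (g z) + 1).
  assert (HM : 0 < M) by (unfold M; lra).
  set (e := eps / (3 * M)).
  assert (He : 0 < e) by (apply Rdiv_lt_0_compat; lra).
  assert (Ee : 3 * M * e = eps) by (unfold e; field; lra).
  destruct (Hf e He) as (d1 & Hd1 & K1).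
  destruct (Hg e He) as (d2 & Hd2 & K2).
  (* The bound [1] keeps [Cmod (g w)] below [M]; the bound [e] controls the cross term
     [l (w - z) (g w - g z)]. The three error terms then share [eps = 3 M e]. *)
  destruct (C_diff_cont g z m Hg (Rmin 1 e)) as (d3 & Hd3 & K3); [apply Rmin_pos; lra|].
  exists (Rmin d1 (Rmin d2 d3)); split; [repeat apply Rmin_pos; auto|]; intros w Hw.
  assert (W1 := Rlt_le_trans _ _ _ Hw (Rmin_l _ _)).
  assert (W' := Rlt_le_trans _ _ _ Hw (Rmin_r _ _)).
  assert (W2 := Rlt_le_trans _ _ _ W' (Rmin_l _ _)).
  assert (W3 := Rlt_le_trans _ _ _ W' (Rmin_r _ _)).
  assert (H1 := K1 w W1); assert (H2 := K2 w W2); assert (H3 := K3 w W3).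
  assert (H4 := Rlt_le_trans _ _ _ H3 (Rmin_l _ _)).
  assert (H5 := Rlt_le_trans _ _ _ H3 (Rmin_r _ _)).
  replace (f w * g w - f z * g z - (l * g z + f z * m) * (w - z))%C
    with ((f w - f z - l * (w - z)) * g w + f z * (g w - g z - m * (w - z))
          + l * (w - z) * (g w - g z))%C by ring.
  assert (H6 : Cmod (g w) <= M).
  { generalize (Cmod_triangle_rev (g w) (g z)); unfold M; lra. }
  eapply Rle_trans; [apply Cmod_triangle|].
  assert (H7 := Cmod_triangle ((f w - f z - l * (w - z)) * g w)
                              (f z * (g w - g z - m * (w - z)))).
  rewrite !Cmod_mult in *.
  pose proof (Cmod_ge_0 (w - z)) as Hw0.
  assert (T1 : Cmod (f w - f z - l * (w - z)) * Cmod (g w) <= e * Cmod (w - z) * M).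
  { apply Rmult_le_compat; auto using Cmod_ge_0. }
  assert (T2 : Cmod (f z) * Cmod (g w - g z - m * (w - z)) <= M * (e * Cmod (w - z))).
  { apply Rmult_le_compat; auto using Cmod_ge_0; unfold M; lra. }
  assert (T3 : Cmod l * Cmod (w - z) * Cmod (g w - g z) <= M * Cmod (w - z) * e).
  { apply Rmult_le_compat; auto using Cmod_ge_0, Rmult_le_pos; [|lra].
    apply Rmult_le_compat_r; auto; unfold M; lra. }
  nra.
Qed.

Lemma C_diff_inv (z : C) : z <> 0%C -> C_diff Cinv z (- / (z * z))%C.
Proof.
  intros Hz eps Heps.
  assert (Hz0 : 0 < Cmod z) by now apply Cmod_gt_0.
  set (t := Cmod z) in *.
  (* The error of the linear approximation is exactly [(w - z)^2 / (w z^2)]. The first radius gives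
     [|w| > t / 2], hence [|w z^2| > t^3 / 2]; the second then makes one factor [|w - z|] small
     enough. *)
  exists (Rmin (t / 2) (eps * (t * t * t) / 2)); split.
  { apply Rmin_pos; [lra|]; apply Rdiv_lt_0_compat; [|lra]; repeat apply Rmult_lt_0_compat; auto. }
  intros w Hw.
  assert (W1 := Rlt_le_trans _ _ _ Hw (Rmin_l _ _)).
  assert (W2 := Rlt_le_trans _ _ _ Hw (Rmin_r _ _)).
  assert (Hwm : t / 2 < Cmod w).
  { generalize (Cmod_triangle_rev z w); rewrite (Cmod_minus_sym z w); fold t; lra. }
  assert (Hw0 : w <> 0%C) by (apply Cmod_gt_0; lra).
  replace (/ w - / z - - / (z * z) * (w - z))%C
    with ((w - z) * (w - z) * / (w * z * z))%C by (field; auto).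
  rewrite !Cmod_mult, Cmod_inv, !Cmod_mult by (repeat apply Cmult_neq_0; auto).
  fold t; pose proof (Cmod_ge_0 (w - z)) as Hd0.
  rewrite (Rmult_comm eps), Rmult_assoc; apply Rmult_le_compat_l; auto.
  change (Cmod (w - z) / (Cmod w * t * t) <= eps).
  apply Rle_div_l; [repeat apply Rmult_lt_0_compat; lra|].
  assert (t / 2 * (t * t) <= Cmod w * (t * t)) by (apply Rmult_le_compat_r; nra).
  nra.
Qed.

Lemma C_diff_comp (f g : C -> C) (z l m : C) :
  C_diff f (g z) l -> C_diff g z m -> C_diff (fun w => f (g w)) z (l * m)%C.
Proof.
  intros Hf Hg eps Heps.
  pose proof (Cmod_ge_0 l) as Hl0.
  pose proof (Cmod_ge_0 m) as Hm0.
  set (e1 := eps / (2 * (Cmod m + 1))).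
  assert (He1 : 0 < e1) by (apply Rdiv_lt_0_compat; lra).
  assert (E1 : e1 * (Cmod m + 1) = eps / 2) by (unfold e1; field; lra).
  set (e2 := Rmin 1 (eps / (2 * (Cmod l + 1)))).
  assert (He2 : 0 < e2) by (apply Rmin_pos; [lra | apply Rdiv_lt_0_compat; lra]).
  assert (E2 : e2 * (Cmod l + 1) <= eps / 2).
  { replace (eps / 2) with (eps / (2 * (Cmod l + 1)) * (Cmod l + 1)) by (field; lra).
    apply Rmult_le_compat_r; [lra | apply Rmin_r]. }
  assert (E3 : e2 <= 1) by apply Rmin_l.
  destruct (Hf e1 He1) as (d1 & Hd1 & K1).
  destruct (Hg e2 He2) as (d2 & Hd2 & K2).
  destruct (C_diff_cont g z m Hg d1 Hd1) as (d3 & Hd3 & K3).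
  exists (Rmin d2 d3); split; [now apply Rmin_pos|]; intros w Hw.
  assert (H2 := K2 w (Rlt_le_trans _ _ _ Hw (Rmin_l _ _))).
  assert (H3 := K3 w (Rlt_le_trans _ _ _ Hw (Rmin_r _ _))).
  assert (H1 := K1 _ H3).
  replace (f (g w) - f (g z) - l * m * (w - z))%C
    with ((f (g w) - f (g z) - l * (g w - g z)) + l * (g w - g z - m * (w - z)))%C by ring.
  eapply Rle_trans; [apply Cmod_triangle|].
  rewrite Cmod_mult.
  assert (H4 : Cmod (g w - g z) <= (Cmod m + 1) * Cmod (w - z)).
  { generalize (Cmod_triangle (g w - g z - m * (w - z)) (m * (w - z))).
    replace (g w - g z - m * (w - z) + m * (w - z))%C with (g w - g z)%C by ring.
    rewrite Cmod_mult; pose proof (Cmod_ge_0 (w - z)); nra. }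
  pose proof (Cmod_ge_0 (w - z)).
  assert (e1 * Cmod (g w - g z) <= e1 * ((Cmod m + 1) * Cmod (w - z)))
    by (apply Rmult_le_compat_l; lra).
  assert (Cmod l * Cmod (g w - g z - m * (w - z)) <= Cmod l * (e2 * Cmod (w - z)))
    by (apply Rmult_le_compat_l; lra).
  nra.
Qed.

Lemma C_differentiable_const (c z : C) : C_differentiable (fun _ => c) z.
Proof. eexists; apply C_diff_const. Qed.

Lemma C_differentiable_id (z : C) : C_differentiable (fun w => w) z.
Proof. eexists; apply C_diff_id. Qed.

Lemma C_differentiable_plus (f g : C -> C) (z : C) :
  C_differentiable f z -> C_differentiable g z ->
  C_differentiable (fun w => f w + g w)%C z.
Proof. intros [l Hl] [m Hm]; eexists; apply C_diff_plus; eauto. Qed.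

Lemma C_differentiable_mult (f g : C -> C) (z : C) :
  C_differentiable f z -> C_differentiable g z ->
  C_differentiable (fun w => f w * g w)%C z.
Proof. intros [l Hl] [m Hm]; eexists; apply C_diff_mult; eauto. Qed.

Lemma C_differentiable_comp (f g : C -> C) (z : C) :
  C_differentiable f (g z) -> C_differentiable g z ->
  C_differentiable (fun w => f (g w)) z.
Proof. intros [l Hl] [m Hm]; eexists; apply C_diff_comp; eauto. Qed.

Lemma C_differentiable_opp (f : C -> C) (z : C) :
  C_differentiable f z -> C_differentiable (fun w => - f w)%C z.
Proof.
  intros [l Hl]; exists (- (1) * l)%C.
  apply (C_diff_comp (fun u => - u)%C f); auto.
  intros eps Heps; exists 1; split; [lra|]; intros w _.
  replace (- w - - f z - - (1) * (w - f z))%C with (RtoC 0) by ring.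
  rewrite Cmod_0; apply Rmult_le_pos; [lra | apply Cmod_ge_0].
Qed.

Lemma C_differentiable_minus (f g : C -> C) (z : C) :
  C_differentiable f z -> C_differentiable g z ->
  C_differentiable (fun w => f w - g w)%C z.
Proof. intros Hf Hg; apply C_differentiable_plus, C_differentiable_opp; auto. Qed.

Lemma C_differentiable_div (f g : C -> C) (z : C) :
  C_differentiable f z -> C_differentiable g z -> g z <> 0%C ->
  C_differentiable (fun w => f w / g w)%C z.
Proof.
  intros Hf Hg Hz; apply C_differentiable_mult; auto.
  apply (C_differentiable_comp Cinv g); auto.
  eexists; now apply C_diff_inv.
Qed.

Lemma C_differentiable_pow (f : C -> C) (n : nat) (z : C) :
  C_differentiable f z -> C_differentiable (fun w => f w ^ n)%C z.
Proof.
  intros Hf; induction n as [|n IH]; simpl.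
  - apply C_differentiable_const.
  - now apply C_differentiable_mult.
Qed.

Create HintDb cdiff.
#[global] Hint Resolve C_differentiable_const C_differentiable_id C_differentiable_plus
  C_differentiable_mult C_differentiable_minus C_differentiable_opp
  C_differentiable_div C_differentiable_pow : cdiff.

(** * Goursat's theorem for rectangles *)

Lemma nested_intervals (a b : nat -> R) :
  (forall n, a n <= a (S n)) -> (forall n, b (S n) <= b n) -> (forall n, a n <= b n) ->
  exists x, forall n, a n <= x <= b n.
Proof.
  intros Ha Hb Hab.
  assert (Ha' : forall n k, a n <= a (k + n)%nat).
  { intros n; induction k as [|k IH]; simpl; [lra | eapply Rle_trans; eauto]. }
  assert (Hb' : forall n k, b (k + n)%nat <= b n).
  { intros n; induction k as [|k IH]; simpl; [lra | eapply Rle_trans; eauto]. }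
  assert (Hmn : forall m n, a m <= b n).
  { intros m n; eapply Rle_trans; [apply (Ha' m n)|].
    eapply Rle_trans; [apply Hab|].
    rewrite Nat.add_comm; apply Hb'. }
  destruct (completeness (fun r => exists n, r = a n)) as [x [Hx1 Hx2]].
  - exists (b O); intros r [n ->]; apply Hmn.
  - exists (a O), O; reflexivity.
  - exists x; intros n; split.
    + apply Hx1; now exists n.
    + apply Hx2; intros r [m ->]; apply Hmn.
Qed.

(** The real part of the integral of [F] along the boundary of
    [[x0, x1] * [y0, y1]], with opposite sides paired. *)
Definition re_bdry_int (F : C -> C) (x0 x1 y0 y1 : R) : R :=
  RInt (fun t => Re (F (t, y0)) - Re (F (t, y1))) x0 x1
  - RInt (fun t => Im (F (x1, t)) - Im (F (x0, t))) y0 y1.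

Definition C_diff_rect (F : C -> C) (x0 x1 y0 y1 : R) : Prop :=
  forall x y, x0 <= x <= x1 -> y0 <= y <= y1 -> C_differentiable F (x, y).

Lemma Cmod_le_Rabs (x y : R) : Cmod (x, y) <= Rabs x + Rabs y.
Proof.
  unfold Cmod; simpl fst; simpl snd.
  apply Rsqr_incr_0_var.
  - rewrite Rsqr_sqrt by nra; unfold Rsqr.
    rewrite <- (pow2_abs x), <- (pow2_abs y).
    pose proof (Rabs_pos x); pose proof (Rabs_pos y); nra.
  - pose proof (Rabs_pos x); pose proof (Rabs_pos y); lra.
Qed.

Lemma im_le_Cmod (z : C) : Rabs (Im z) <= Cmod z.
Proof. eapply Rle_trans; [apply Rmax_r | apply Rmax_Cmod]. Qed.

Lemma continuous_horizontal (F : C -> C) (x y : R) :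
  C_differentiable F (x, y) ->
  continuous (fun t => Re (F (t, y))) x /\ continuous (fun t => Im (F (t, y))) x.
Proof.
  intros [l Hl]; split; apply continuity_pt_filterlim; intros eps Heps;
    destruct (C_diff_cont F _ l Hl eps Heps) as (d & Hd & K);
    (exists d; split; [assumption|]); intros t [_ Ht]; cbn -[Cmod Re Im] in *;
    unfold R_dist in *;
    assert (K1 : Cmod (F (t, y) - F (x, y)) < eps) by
      (apply K; replace ((t, y) - (x, y))%C with (RtoC (t - x));
        [rewrite Cmod_R; exact Ht | apply injective_projections; simpl; ring]);
    eapply Rle_lt_trans; [|exact K1| |exact K1].
  - eapply Rle_trans; [|apply re_le_Cmod]; right; reflexivity.
  - eapply Rle_trans; [|apply im_le_Cmod]; right; reflexivity.
Qed.

Lemma continuous_vertical (F : C -> C) (x y : R) :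
  C_differentiable F (x, y) ->
  continuous (fun t => Re (F (x, t))) y /\ continuous (fun t => Im (F (x, t))) y.
Proof.
  intros [l Hl]; split; apply continuity_pt_filterlim; intros eps Heps;
    destruct (C_diff_cont F _ l Hl eps Heps) as (d & Hd & K);
    (exists d; split; [assumption|]); intros t [_ Ht]; cbn -[Cmod Re Im] in *;
    unfold R_dist in *;
    assert (K1 : Cmod (F (x, t) - F (x, y)) < eps) by
      (apply K; replace ((x, t) - (x, y))%C with (Ci * RtoC (t - y))%C;
        [rewrite Cmod_mult, Cmod_Ci, Cmod_R, Rmult_1_l; exact Ht
        | apply injective_projections; simpl; ring]);
    eapply Rle_lt_trans; [|exact K1| |exact K1].
  - eapply Rle_trans; [|apply re_le_Cmod]; right; reflexivity.
  - eapply Rle_trans; [|apply im_le_Cmod]; right; reflexivity.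
Qed.

Lemma ex_RInt_horizontal (F : C -> C) (x0 x1 y0 y1 y : R) :
  x0 <= x1 -> y0 <= y <= y1 -> C_diff_rect F x0 x1 y0 y1 ->
  ex_RInt (fun t => Re (F (t, y))) x0 x1.
Proof.
  intros Hx Hy HF; apply (@ex_RInt_continuous R_CompleteNormedModule).
  rewrite Rmin_left, Rmax_right by lra.
  intros t Ht; apply continuous_horizontal; auto.
Qed.

Lemma ex_RInt_vertical (F : C -> C) (x0 x1 y0 y1 x : R) :
  y0 <= y1 -> x0 <= x <= x1 -> C_diff_rect F x0 x1 y0 y1 ->
  ex_RInt (fun t => Im (F (x, t))) y0 y1.
Proof.
  intros Hy Hx HF; apply (@ex_RInt_continuous R_CompleteNormedModule).
  rewrite Rmin_left, Rmax_right by lra.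
  intros t Ht; apply continuous_vertical; auto.
Qed.

Lemma RInt_Rminus (f g : R -> R) (a b : R) : ex_RInt f a b -> ex_RInt g a b ->
  RInt (fun t => f t - g t) a b = RInt f a b - RInt g a b.
Proof. exact (RInt_minus f g a b). Qed.

Lemma RInt_Chasles_R (f : R -> R) (a b c : R) : ex_RInt f a b -> ex_RInt f b c ->
  RInt f a b + RInt f b c = RInt f a c.
Proof. exact (RInt_Chasles f a b c). Qed.

Lemma C_diff_rect_sub (F : C -> C) (x0 x1 y0 y1 a0 a1 b0 b1 : R) :
  C_diff_rect F x0 x1 y0 y1 -> x0 <= a0 -> a1 <= x1 -> y0 <= b0 -> b1 <= y1 ->
  C_diff_rect F a0 a1 b0 b1.
Proof. intros H ? ? ? ? x y ? ?; apply H; lra. Qed.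

(** Sides shared by two of the four rectangles are traversed in opposite directions and cancel. *)
Lemma re_bdry_int_split (F : C -> C) (x0 x1 x2 y0 y1 y2 : R) :
  x0 <= x1 <= x2 -> y0 <= y1 <= y2 -> C_diff_rect F x0 x2 y0 y2 ->
  re_bdry_int F x0 x2 y0 y2 =
    re_bdry_int F x0 x1 y0 y1 + re_bdry_int F x1 x2 y0 y1
    + re_bdry_int F x0 x1 y1 y2 + re_bdry_int F x1 x2 y1 y2.
Proof.
  intros Hx Hy HF; unfold re_bdry_int.
  assert (EH : forall y, y0 <= y <= y2 ->
    ex_RInt (fun t => Re (F (t, y))) x0 x1 /\ ex_RInt (fun t => Re (F (t, y))) x1 x2).
  { intros y H; split; (eapply ex_RInt_horizontal; [lra | exact H |]);
      eapply C_diff_rect_sub; eauto; lra. }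
  assert (EV : forall x, x0 <= x <= x2 ->
    ex_RInt (fun t => Im (F (x, t))) y0 y1 /\ ex_RInt (fun t => Im (F (x, t))) y1 y2).
  { intros x H; split; (eapply ex_RInt_vertical; [lra | exact H |]);
      eapply C_diff_rect_sub; eauto; lra. }
  destruct (EH y0) as [? ?]; [lra|]. destruct (EH y1) as [? ?]; [lra|].
  destruct (EH y2) as [? ?]; [lra|].
  destruct (EV x0) as [? ?]; [lra|]. destruct (EV x1) as [? ?]; [lra|].
  destruct (EV x2) as [? ?]; [lra|].
  assert (EC : forall f a b c, ex_RInt f a b -> ex_RInt f b c -> ex_RInt f a c)
    by apply (@ex_RInt_Chasles R_NormedModule).
  rewrite !RInt_Rminus by (eauto using EC).
  rewrite <- (RInt_Chasles_R (fun t => Re (F (t, y0))) x0 x1 x2),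
    <- (RInt_Chasles_R (fun t => Re (F (t, y2))) x0 x1 x2),
    <- (RInt_Chasles_R (fun t => Im (F (x0, t))) y0 y1 y2),
    <- (RInt_Chasles_R (fun t => Im (F (x2, t))) y0 y1 y2) by auto.
  ring.
Qed.

Lemma RInt_near_const (g : R -> R) (a b c M : R) : a <= b -> ex_RInt g a b ->
  (forall t, a <= t <= b -> Rabs (g t - c) <= M) ->
  Rabs (RInt g a b - (b - a) * c) <= (b - a) * M.
Proof.
  intros Hab Hg HM.
  assert (Hc : ex_RInt (fun _ : R => c) a b) by apply ex_RInt_const.
  assert (E : RInt (fun t => g t - c) a b = RInt g a b - (b - a) * c).
  { rewrite RInt_Rminus by auto; rewrite RInt_const; reflexivity. }
  rewrite <- E; apply abs_RInt_le_const; auto.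
  now apply (@ex_RInt_minus R_NormedModule).
Qed.

(* On a small rectangle the affine part of [F] has zero boundary integral, because
   the differences over opposite sides are constants that cancel. *)
Lemma re_bdry_int_local (F : C -> C) (x0 x1 y0 y1 : R) (z l : C) (e : R) :
  x0 <= x1 -> y0 <= y1 -> 0 <= e -> C_diff_rect F x0 x1 y0 y1 ->
  x0 <= Re z <= x1 -> y0 <= Im z <= y1 ->
  (forall x y, x0 <= x <= x1 -> y0 <= y <= y1 ->
     Cmod (F (x, y) - F z - l * ((x, y) - z))%C <= e * Cmod ((x, y) - z)%C) ->
  Rabs (re_bdry_int F x0 x1 y0 y1) <= 2 * e * ((x1 - x0) + (y1 - y0)) ^ 2.
Proof.
  intros Hx Hy He HF Hzx Hzy HL.
  set (W := x1 - x0) in *; set (H := y1 - y0) in *.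
  assert (B : forall x y, x0 <= x <= x1 -> y0 <= y <= y1 ->
    Cmod (F (x, y) - F z - l * ((x, y) - z))%C <= e * (W + H)).
  { intros x y Kx Ky; eapply Rle_trans; [apply HL; auto|].
    apply Rmult_le_compat_l; auto.
    destruct z as [zx zy]; simpl in Hzx, Hzy.
    replace ((x, y) - (zx, zy))%C with (x - zx, y - zy)
      by (apply injective_projections; simpl; ring).
    eapply Rle_trans; [apply Cmod_le_Rabs|].
    apply Rplus_le_compat; apply Rabs_le; unfold W, H; lra. }
  assert (I1 : Rabs (RInt (fun t => Re (F (t, y0)) - Re (F (t, y1))) x0 x1 - W * (Im l * H))
            <= W * (2 * (e * (W + H)))).
  { apply RInt_near_const; auto.
    - apply (@ex_RInt_minus R_NormedModule);
        (eapply ex_RInt_horizontal; [lra | | exact HF]; lra).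
    - intros t Ht.
      assert (B0 := B t y0 Ht ltac:(lra)); assert (B1 := B t y1 Ht ltac:(lra)).
      assert (R0 := Rle_trans _ _ _ (re_le_Cmod _) B0).
      assert (R1 := Rle_trans _ _ _ (re_le_Cmod _) B1).
      replace (Re (F (t, y0)) - Re (F (t, y1)) - Im l * H) with
        (Re (F (t, y0) - F z - l * ((t, y0) - z))%C - Re (F (t, y1) - F z - l * ((t, y1) - z))%C).
      + apply Rabs_le; apply Rabs_le_between in R0; apply Rabs_le_between in R1; lra.
      + unfold H, Re, Im; simpl; ring. }
  assert (I2 : Rabs (RInt (fun t => Im (F (x1, t)) - Im (F (x0, t))) y0 y1 - H * (Im l * W))
            <= H * (2 * (e * (W + H)))).
  { apply RInt_near_const; auto.
    - apply (@ex_RInt_minus R_NormedModule);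
        (eapply ex_RInt_vertical; [lra | | exact HF]; lra).
    - intros t Ht.
      assert (B0 := B x0 t ltac:(lra) Ht); assert (B1 := B x1 t ltac:(lra) Ht).
      assert (R0 := Rle_trans _ _ _ (im_le_Cmod _) B0).
      assert (R1 := Rle_trans _ _ _ (im_le_Cmod _) B1).
      replace (Im (F (x1, t)) - Im (F (x0, t)) - Im l * W) with
        (Im (F (x1, t) - F z - l * ((x1, t) - z))%C - Im (F (x0, t) - F z - l * ((x0, t) - z))%C).
      + apply Rabs_le; apply Rabs_le_between in R0; apply Rabs_le_between in R1; lra.
      + unfold W, Re, Im; simpl; ring. }
  unfold re_bdry_int.
  apply Rabs_le; apply Rabs_le_between in I1; apply Rabs_le_between in I2.
  split; nra.
Qed.

(** Pigeonhole on the four quarters. The corner of the chosen quarter is only located in a range,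
    which is all that the nesting argument uses. *)
Lemma re_bdry_int_step (F : C -> C) (x y W H K : R) :
  0 <= W -> 0 <= H -> C_diff_rect F x (x + W) y (y + H) ->
  K < Rabs (re_bdry_int F x (x + W) y (y + H)) ->
  exists x' y', x <= x' <= x + W / 2 /\ y <= y' <= y + H / 2 /\
    K / 4 < Rabs (re_bdry_int F x' (x' + W / 2) y' (y' + H / 2)).
Proof.
  intros HW HH HF HK.
  apply NNPP; intros N.
  assert (Q : forall x' y', x <= x' <= x + W / 2 -> y <= y' <= y + H / 2 ->
    Rabs (re_bdry_int F x' (x' + W / 2) y' (y' + H / 2)) <= K / 4).
  { intros x' y' Hx' Hy'; apply Rnot_lt_le; intros L; apply N; now exists x', y'. }
  revert HK; apply Rle_not_lt.
  rewrite (re_bdry_int_split F x (x + W / 2) (x + W) y (y + H / 2) (y + H)) by (auto; lra).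
  assert (Q1 := Q x y ltac:(lra) ltac:(lra)).
  assert (Q2 := Q (x + W / 2) y ltac:(lra) ltac:(lra)).
  assert (Q3 := Q x (y + H / 2) ltac:(lra) ltac:(lra)).
  assert (Q4 := Q (x + W / 2) (y + H / 2) ltac:(lra) ltac:(lra)).
  replace (x + W / 2 + W / 2) with (x + W) in * by field.
  replace (y + H / 2 + H / 2) with (y + H) in * by field.
  apply Rabs_le; apply Rabs_le_between in Q1, Q2, Q3, Q4; lra.
Qed.

Theorem goursat_rect (F : C -> C) (x0 x1 y0 y1 : R) :
  x0 <= x1 -> y0 <= y1 -> C_diff_rect F x0 x1 y0 y1 ->
  re_bdry_int F x0 x1 y0 y1 = 0.
Proof.
  intros Hx Hy HF.
  set (W := x1 - x0); set (H := y1 - y0).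
  destruct (Req_dec (re_bdry_int F x0 x1 y0 y1) 0) as [E|N]; [exact E|exfalso].
  apply Rabs_pos_lt in N.
  (* Half of the modulus, so that the strict inequality in [bad] holds at generation [0]; the local
     estimate at the end then only has to reach [c / 4 ^ n] weakly. *)
  set (c := Rabs (re_bdry_int F x0 x1 y0 y1) / 2).
  assert (Hc : 0 < c) by (unfold c; lra).
  set (w := fun n => W / 2 ^ n); set (h := fun n => H / 2 ^ n).
  assert (P2 : forall n, 0 < 2 ^ n) by (intros n; apply pow_lt; lra).
  assert (Pw : forall n, 0 <= w n)
    by (intros n; apply Rle_div_r; [apply Rlt_gt, P2 | unfold W; lra]).
  assert (Ph : forall n, 0 <= h n)
    by (intros n; apply Rle_div_r; [apply Rlt_gt, P2 | unfold H; lra]).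
  assert (Sw : forall n, w (S n) = w n / 2)
    by (intros n; unfold w; simpl; field; apply Rgt_not_eq, P2).
  assert (Sh : forall n, h (S n) = h n / 2)
    by (intros n; unfold h; simpl; field; apply Rgt_not_eq, P2).
  pose (bad := fun n (p : R * R) =>
    x0 <= fst p /\ fst p + w n <= x1 /\ y0 <= snd p /\ snd p + h n <= y1 /\
    c / 4 ^ n < Rabs (re_bdry_int F (fst p) (fst p + w n) (snd p) (snd p + h n))).
  assert (step : forall n p, bad n p -> exists q, bad (S n) q /\
    fst p <= fst q /\ fst q + w (S n) <= fst p + w n /\
    snd p <= snd q /\ snd q + h (S n) <= snd p + h n).
  { intros n p (B1 & B2 & B3 & B4 & B5).
    destruct (re_bdry_int_step F (fst p) (snd p) (w n) (h n) (c / 4 ^ n))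
      as (x' & y' & Q1 & Q2 & Q3); auto.
    { eapply C_diff_rect_sub; eauto. }
    exists (x', y'); unfold bad; simpl fst; simpl snd.
    rewrite Sw, Sh; repeat split; try lra.
    replace (c / 4 ^ S n) with (c / 4 ^ n / 4); auto.
    simpl; field; apply pow_nonzero; lra. }
  assert (start : bad O (x0, y0)).
  { unfold bad, w, h; simpl.
    replace (x0 + W / 1) with x1 by (unfold W; field).
    replace (y0 + H / 1) with y1 by (unfold H; field).
    repeat split; try lra; unfold c; lra. }
  (* Dependent choice: the proof of [bad] is carried along with the corner, since [step] needs it to
     choose the next rectangle. *)
  pose (seq := nat_rect (fun n => {p | bad n p}) (exist _ _ start)
    (fun n s => let (q, Hq) := constructive_indefinite_description _
                   (step n (proj1_sig s) (proj2_sig s)) in exist _ q (proj1 Hq))).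
  pose (pt := fun n => proj1_sig (seq n)).
  assert (Hpt : forall n, bad n (pt n)) by (intros n; exact (proj2_sig (seq n))).
  assert (Spt : forall n,
    fst (pt n) <= fst (pt (S n)) /\ fst (pt (S n)) + w (S n) <= fst (pt n) + w n /\
    snd (pt n) <= snd (pt (S n)) /\ snd (pt (S n)) + h (S n) <= snd (pt n) + h n).
  { intros n; unfold pt; simpl.
    destruct (constructive_indefinite_description _ _) as [q [Hq1 Hq2]]; exact Hq2. }
  destruct (nested_intervals (fun n => fst (pt n)) (fun n => fst (pt n) + w n)) as [zx Hzx];
    try (intros n; destruct (Spt n); specialize (Pw n); simpl; lra).
  destruct (nested_intervals (fun n => snd (pt n)) (fun n => snd (pt n) + h n)) as [zy Hzy];
    try (intros n; destruct (Spt n) as (? & ? & ? & ?); specialize (Ph n); simpl; lra).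
  simpl in Hzx, Hzy.
  destruct (HF zx zy) as [l Hl].
  { destruct (Hpt O) as (? & ? & ? & ? & ?), (Hzx O); lra. }
  { destruct (Hpt O) as (? & ? & ? & ? & ?), (Hzy O); lra. }
  set (S2 := (W + H) ^ 2).
  assert (HS2 : 0 <= S2) by apply pow2_ge_0.
  (* The [+ 1] keeps the denominator positive when the rectangle is a single point. *)
  set (e := c / (2 * (S2 + 1))).
  assert (He : 0 < e) by (apply Rdiv_lt_0_compat; lra).
  assert (Ee : 2 * e * (S2 + 1) = c) by (unfold e; field; lra).
  destruct (Hl e He) as (d & Hd & K).
  assert (exists n, W + H < d * 2 ^ n) as [n Hn].
  { destruct (Pow_x_infinity 2 ltac:(rewrite Rabs_pos_eq; lra) ((W + H) / d + 1)) as [n Hn].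
    exists n; specialize (Hn n (Nat.le_refl n)).
    rewrite Rabs_pos_eq in Hn by (left; apply P2).
    assert (L : (W + H) / d < 2 ^ n) by lra.
    apply Rlt_div_l in L; lra. }
  assert (Hwh : w n + h n < d).
  { unfold w, h; rewrite <- Rdiv_plus_distr; apply Rlt_div_l; [apply Rlt_gt, P2 | lra]. }
  destruct (Hpt n) as (B1 & B2 & B3 & B4 & B5).
  revert B5; apply Rle_not_lt.
  specialize (Hzx n); specialize (Hzy n); specialize (Pw n); specialize (Ph n).
  eapply Rle_trans.
  { eapply (re_bdry_int_local F _ _ _ _ (zx, zy) l e); simpl; try lra.
    - eapply C_diff_rect_sub; eauto.
    - intros x y Kx Ky; apply K.
      replace ((x, y) - (zx, zy))%C with (x - zx, y - zy)
        by (apply injective_projections; simpl; ring).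
      eapply Rle_lt_trans; [apply Cmod_le_Rabs|].
      assert (Rabs (x - zx) <= w n) by (apply Rabs_le; lra).
      assert (Rabs (y - zy) <= h n) by (apply Rabs_le; lra).
      lra. }
  replace (2 * e * (fst (pt n) + w n - fst (pt n) + (snd (pt n) + h n - snd (pt n))) ^ 2)
    with (2 * e * S2 / 4 ^ n).
  - apply Rmult_le_compat_r; [|nra].
    left; apply Rinv_0_lt_compat, pow_lt; lra.
  - unfold S2, w, h; replace 4 with (2 * 2) by ring; rewrite Rpow_mult_distr.
    field; apply Rgt_not_eq, P2.
Qed.

(** * The mean value inequality *)

Definition Cexp (z : C) : C := (exp (Re z) * cos (Im z), exp (Re z) * sin (Im z)).

Lemma Cexp_plus (z w : C) : Cexp (z + w)%C = (Cexp z * Cexp w)%C.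
Proof.
  destruct z as [a b], w as [c d]; unfold Cexp, Re, Im; simpl.
  rewrite exp_plus, cos_plus, sin_plus.
  apply injective_projections; simpl; ring.
Qed.

Lemma Cmod_Cexp (z : C) : Cmod (Cexp z) = exp (Re z).
Proof.
  unfold Cexp, Cmod; simpl fst; simpl snd.
  replace ((exp (Re z) * cos (Im z)) ^ 2 + (exp (Re z) * sin (Im z)) ^ 2)
    with (exp (Re z) ^ 2 * (Rsqr (sin (Im z)) + Rsqr (cos (Im z)))) by (unfold Rsqr; ring).
  rewrite sin2_cos2, Rmult_1_r; apply sqrt_pow2; left; apply exp_pos.
Qed.

Lemma derivable_pt_lim_0_bound (f : R -> R) (l eps : R) : derivable_pt_lim f 0 l -> 0 < eps ->
  exists d, 0 < d /\ forall t, Rabs t < d -> Rabs (f t - f 0 - l * t) <= eps * Rabs t.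
Proof.
  intros Hf Heps; destruct (Hf eps Heps) as [d Hd].
  exists d; split; [apply cond_pos|]; intros t Ht.
  destruct (Req_dec t 0) as [->|N].
  - replace (f 0 - f 0 - l * 0) with 0 by ring; rewrite Rabs_R0; lra.
  - generalize (Hd t N Ht); rewrite Rplus_0_l; intros K.
    replace (f t - f 0 - l * t) with (((f t - f 0) / t - l) * t) by (field; auto).
    rewrite Rabs_mult; apply Rmult_le_compat_r; [apply Rabs_pos | lra].
Qed.

Lemma C_diff_Cexp_0 : C_diff Cexp 0%C 1%C.
Proof.
  intros eps Heps.
  (* The two components of the error come out below [4 e r] and [5 e r], so [12] leaves room. The
     bound [1] gives [|exp x - 1| <= 2 |x|] and [exp x <= 3]. *)
  set (e := Rmin 1 (eps / 12)).
  assert (He : 0 < e) by (apply Rmin_pos; lra).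
  assert (He1 : e <= 1) by apply Rmin_l.
  assert (He2 : e <= eps / 12) by apply Rmin_r.
  destruct (derivable_pt_lim_0_bound _ _ e derivable_pt_lim_exp_0 He) as (d1 & Hd1 & K1).
  destruct (derivable_pt_lim_0_bound _ _ e (derivable_pt_lim_cos 0) He) as (d2 & Hd2 & K2).
  destruct (derivable_pt_lim_0_bound _ _ e (derivable_pt_lim_sin 0) He) as (d3 & Hd3 & K3).
  exists (Rmin (Rmin d1 d2) (Rmin d3 e)); split; [apply Rmin_pos; apply Rmin_pos; assumption|].
  intros [x y] Hw.
  replace ((x, y) - 0)%C with ((x, y) : C) in * by (apply injective_projections; simpl; ring).
  assert (Hx : Rabs x <= Cmod (x, y)) by apply (re_le_Cmod (x, y)).
  assert (Hy : Rabs y <= Cmod (x, y)) by apply (im_le_Cmod (x, y)).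
  set (r := Cmod (x, y)) in *.
  assert (W1 := Rlt_le_trans _ _ _ Hw (Rmin_l _ _)).
  assert (W2 := Rlt_le_trans _ _ _ Hw (Rmin_r _ _)).
  assert (R1 := Rlt_le_trans _ _ _ W1 (Rmin_l _ _)).
  assert (R2 := Rlt_le_trans _ _ _ W1 (Rmin_r _ _)).
  assert (R3 := Rlt_le_trans _ _ _ W2 (Rmin_l _ _)).
  assert (R4 := Rlt_le_trans _ _ _ W2 (Rmin_r _ _)).
  assert (B1 := K1 x ltac:(lra)); assert (B2 := K2 y ltac:(lra)); assert (B3 := K3 y ltac:(lra)).
  rewrite exp_0 in B1; rewrite cos_0, sin_0 in B2; rewrite sin_0, cos_0 in B3.
  pose proof (Rabs_pos x) as Px; pose proof (Rabs_pos y) as Py.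
  replace (Cexp (x, y) - Cexp 0 - 1 * (x, y))%C
    with (exp x * cos y - 1 - x, exp x * sin y - y)
    by (unfold Cexp; rewrite re_RtoC, im_RtoC, exp_0, cos_0, sin_0;
        apply injective_projections; simpl; ring).
  assert (E1 : Rabs (exp x - 1) <= 2 * Rabs x).
  { replace (exp x - 1) with ((exp x - 1 - 1 * x) + x) by ring.
    eapply Rle_trans; [apply Rabs_triang | nra]. }
  assert (E3 : exp x <= 3).
  { apply Rabs_le_between in E1; lra. }
  pose proof (exp_pos x) as E0.
  eapply Rle_trans; [apply Cmod_le_Rabs|].
  assert (Q1 : Rabs (exp x * cos y - 1 - x) <= 4 * e * r).
  { replace (exp x * cos y - 1 - x)
      with (exp x * (cos y - 1 - - 0 * y) + (exp x - 1 - 1 * x)) by ring.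
    eapply Rle_trans; [apply Rabs_triang|].
    rewrite Rabs_mult, (Rabs_pos_eq (exp x)) by lra.
    assert (exp x * Rabs (cos y - 1 - - 0 * y) <= 3 * (e * r)).
    { apply Rmult_le_compat; try lra; [apply Rabs_pos | nra]. }
    nra. }
  assert (Q2 : Rabs (exp x * sin y - y) <= 5 * e * r).
  { replace (exp x * sin y - y)
      with (exp x * (sin y - 0 - 1 * y) + (exp x - 1) * y) by ring.
    eapply Rle_trans; [apply Rabs_triang|].
    rewrite !Rabs_mult, (Rabs_pos_eq (exp x)) by lra.
    assert (exp x * Rabs (sin y - 0 - 1 * y) <= 3 * (e * r)).
    { apply Rmult_le_compat; try lra; [apply Rabs_pos | nra]. }
    assert (Rabs (exp x - 1) * Rabs y <= 2 * e * r).
    { apply Rmult_le_compat; try lra; apply Rabs_pos. }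
    lra. }
  assert (e * r <= eps / 12 * r) by (apply Rmult_le_compat_r; lra).
  assert (0 <= eps * r) by (apply Rmult_le_pos; lra).
  lra.
Qed.

Lemma C_differentiable_Cexp (z : C) : C_differentiable Cexp z.
Proof.
  exists (Cexp z).
  intros eps Heps.
  assert (Hz : 0 < Cmod (Cexp z)) by (rewrite Cmod_Cexp; apply exp_pos).
  destruct (C_diff_Cexp_0 (eps / Cmod (Cexp z))) as (d & Hd & K).
  { now apply Rdiv_lt_0_compat. }
  exists d; split; auto; intros w Hw.
  assert (E0 : Cexp 0 = 1%C).
  { unfold Cexp; rewrite re_RtoC, im_RtoC, exp_0, cos_0, sin_0.
    apply injective_projections; simpl; ring. }
  specialize (K (w - z)%C).
  replace (w - z - 0)%C with (w - z)%C in K by ring.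
  specialize (K Hw); rewrite E0 in K.
  replace w with (z + (w - z))%C at 1 by ring; rewrite Cexp_plus.
  replace (Cexp z * Cexp (w - z) - Cexp z - Cexp z * (w - z))%C
    with (Cexp z * (Cexp (w - z) - 1 - 1 * (w - z)))%C by ring.
  rewrite Cmod_mult.
  apply (Rmult_le_compat_l (Cmod (Cexp z))) in K; [|lra].
  eapply Rle_trans; [exact K | right; field; lra].
Qed.

Lemma Cexp_2PI (x : R) : Cexp (x, 2 * PI) = Cexp (x, 0).
Proof.
  unfold Cexp, Re, Im; simpl fst; simpl snd.
  now rewrite cos_2PI, sin_2PI, cos_0, sin_0.
Qed.

(* In the coordinate [s], [z = Cexp s], the circles [|z| = rho] become vertical
   segments of length [2 PI], and [goursat_rect] on the rectangle between two of them
   says that [k] has the same mean over both circles: the horizontal sides cancel by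
   periodicity. *)
Lemma Re_le_circle_bound (k : C -> C) (rho M : R) :
  (forall z, unit_disc z -> C_differentiable k z) -> 0 < rho < 1 ->
  (forall z, Cmod z = rho -> Cmod (k z) <= M) -> Re (k 0%C) <= M.
Proof.
  intros Hk [Hr0 Hr1] HM.
  destruct (Rle_lt_dec (Re (k 0%C)) M) as [L|L]; [exact L|exfalso].
  set (eps := (Re (k 0%C) - M) / 2).
  assert (Heps : 0 < eps) by (unfold eps; lra).
  destruct (Hk 0%C) as [l Hl]; [unfold unit_disc; rewrite Cmod_0; lra|].
  destruct (C_diff_cont k _ l Hl eps Heps) as (d & Hd & K).
  (* The inner circle has radius at most [d / 2], where [k] differs from [k 0] by less than [eps];
     the minimum keeps it inside the outer circle. *)
  set (s1 := ln rho); set (s0 := Rmin s1 (ln (d / 2))).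
  assert (Hs01 : s0 <= s1) by apply Rmin_l.
  assert (Hs1 : exp s1 = rho) by now apply exp_ln.
  assert (Hs0 : exp s0 < d).
  { apply Rle_lt_trans with (d / 2); [|lra].
    rewrite <- (exp_ln (d / 2)) by lra.
    destruct (Rmin_r s1 (ln (d / 2))) as [Q|Q].
    - left; now apply exp_increasing.
    - right; unfold s0; now rewrite Q. }
  assert (Hexp : forall s, s <= s1 -> exp s <= rho).
  { intros s [Q| ->]; [|lra]; rewrite <- Hs1; left; now apply exp_increasing. }
  pose proof PI_RGT_0 as HPI.
  (* Multiplication by [Ci] makes [Im F] equal to the real part of [k] on the vertical sides, so the
     real boundary integral alone carries the circle means. *)
  set (F := fun s => (Ci * k (Cexp s))%C).
  assert (HF : C_diff_rect F s0 s1 0 (2 * PI)).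
  { intros x y Hx _; apply C_differentiable_mult; [apply C_differentiable_const|].
    apply (C_differentiable_comp k Cexp); [|apply C_differentiable_Cexp].
    apply Hk; unfold unit_disc; rewrite Cmod_Cexp; simpl.
    eapply Rle_lt_trans; [apply Hexp | exact Hr1]; lra. }
  generalize (goursat_rect F s0 s1 0 (2 * PI) Hs01 ltac:(lra) HF); unfold re_bdry_int.
  rewrite (RInt_ext (fun t => Re (F (t, 0)) - Re (F (t, 2 * PI))) (fun _ => 0)).
  2:{ intros t _; unfold F; rewrite Cexp_2PI; apply Rminus_diag. }
  rewrite RInt_const; unfold scal; simpl; unfold mult; simpl; rewrite Rmult_0_r.
  intros E.
  (* As [eps] is half the gap between [Re (k 0)] and [M], the constant on the right is [- eps]: the
     integral would be negative, while [E] makes it zero. *)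
  assert (B : RInt (fun t => Im (F (s1, t)) - Im (F (s0, t))) 0 (2 * PI)
              <= RInt (fun _ => M - (Re (k 0%C) - eps)) 0 (2 * PI)).
  { apply RInt_le; try lra.
    - apply (@ex_RInt_minus R_NormedModule); (eapply ex_RInt_vertical; [lra | | exact HF]; lra).
    - apply ex_RInt_const.
    - intros t _.
      replace (Im (F (s1, t))) with (Re (k (Cexp (s1, t)))) by (unfold F, Re, Im; simpl; ring).
      replace (Im (F (s0, t))) with (Re (k (Cexp (s0, t)))) by (unfold F, Re, Im; simpl; ring).
      assert (B1 : Re (k (Cexp (s1, t))) <= M).
      { eapply Rle_trans; [apply Rle_abs|].
        eapply Rle_trans; [apply re_le_Cmod|].
        apply HM; rewrite Cmod_Cexp; exact Hs1. }
      assert (B0 : Cmod (k (Cexp (s0, t)) - k 0) < eps).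
      { apply K; replace (Cexp (s0, t) - 0)%C with (Cexp (s0, t)) by ring.
        rewrite Cmod_Cexp; exact Hs0. }
      assert (B2 := Rle_lt_trans _ _ _ (re_le_Cmod _) B0).
      apply Rabs_def2 in B2; unfold Re in *; simpl in B2; lra. }
  rewrite RInt_const in B; unfold scal in B; simpl in B; unfold mult in B; simpl in B.
  assert (0 < PI * eps) by (apply Rmult_lt_0_compat; lra).
  unfold eps in *; nra.
Qed.

(** A constant rotation [u] with [u * k 0 = |k 0|] reduces the modulus to the real part. *)
Lemma Cmod_le_circle_bound (k : C -> C) (rho M : R) :
  (forall z, unit_disc z -> C_differentiable k z) -> 0 < rho < 1 ->
  (forall z, Cmod z = rho -> Cmod (k z) <= M) -> Cmod (k 0%C) <= M.
Proof.
  intros Hk Hr HM.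
  destruct (Ceq_dec (k 0%C) 0%C) as [E|N].
  { rewrite E, Cmod_0; eapply Rle_trans; [apply Cmod_ge_0|].
    apply (HM (RtoC rho)); rewrite Cmod_R; apply Rabs_pos_eq; lra. }
  assert (P : 0 < Cmod (k 0%C)) by now apply Cmod_gt_0.
  set (u := (Cconj (k 0%C) / RtoC (Cmod (k 0%C)))%C).
  assert (NR : RtoC (Cmod (k 0%C)) <> 0%C) by (intros Q; apply RtoC_inj in Q; lra).
  assert (Hu : Cmod u = 1).
  { unfold u; rewrite Cmod_div, Cmod_conj, Cmod_R, Rabs_pos_eq by (auto; lra); field; lra. }
  replace (Cmod (k 0%C)) with (Re (u * k 0)%C).
  - apply (Re_le_circle_bound (fun z => u * k z)%C rho M); auto.
    + intros z Hz; apply C_differentiable_mult; auto; apply C_differentiable_const.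
    + intros z Hz; rewrite Cmod_mult, Hu, Rmult_1_l; auto.
  - replace (u * k 0)%C with (RtoC (Cmod (k 0%C))); [apply re_RtoC|].
    unfold u; transitivity (RtoC (Cmod (k 0%C) ^ 2) / RtoC (Cmod (k 0%C)))%C.
    + rewrite RtoC_pow; field; auto.
    + rewrite Cmod2_conj; field; auto.
Qed.

(** * Schwarz's lemma *)

Lemma Cmod2_Re_Im (z : C) : Cmod z ^ 2 = Re z * Re z + Im z * Im z.
Proof. rewrite Cmod2_alt; ring. Qed.

Lemma neq_0_of_Cmod_lt (z w : C) : Cmod z < Cmod w -> (w - z)%C <> 0%C.
Proof.
  intros H E; generalize (Cmod_triangle_rev w z); rewrite E, Cmod_0; lra.
Qed.

Lemma one_minus_neq_0 (z w : C) : Cmod z < 1 -> Cmod w <= 1 -> (1 - z * w)%C <> 0%C.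
Proof.
  intros Hz Hw; apply neq_0_of_Cmod_lt.
  rewrite Cmod_mult, Cmod_1; pose proof (Cmod_ge_0 z); pose proof (Cmod_ge_0 w); nra.
Qed.

Lemma moebius_Cmod_identity (l z : C) :
  Cmod (1 + Cconj l * z)%C ^ 2 - Cmod (z + l)%C ^ 2 = (1 - Cmod l ^ 2) * (1 - Cmod z ^ 2).
Proof.
  rewrite !Cmod2_Re_Im; unfold Re, Im; simpl; ring.
Qed.

(* Transporting [w] to [0] by a disc automorphism [m] turns the mean value bound at
   the centre into a bound at [w]; on circles of radius close to [1] the modulus of
   [m] is uniformly close to [1]. *)
Lemma disc_max_principle (k : C -> C) (n : nat) :
  (forall z, unit_disc z -> C_differentiable k z) ->
  (forall z, unit_disc z -> Cmod (k z) * Cmod z ^ n <= 1) ->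
  forall w, unit_disc w -> Cmod (k w) <= 1.
Proof.
  intros Hk Hb w Hw.
  destruct (Rle_lt_dec (Cmod (k w)) 1) as [L|L]; [exact L|exfalso].
  unfold unit_disc in Hw; pose proof (Cmod_ge_0 w) as Hw0.
  set (q := 1 - Cmod w).
  (* Chosen so that [K^2 (1 - n e) > 1] with [K = |k w|], which contradicts [K^2 (1 - e)^n <= 1] by
     Bernoulli's inequality. *)
  set (e := Rmin (1 / 2) ((Cmod (k w) ^ 2 - 1) / (2 * Cmod (k w) ^ 2 * (INR n + 1)))).
  pose proof (pos_INR n) as Hn.
  assert (Hkw : 1 < Cmod (k w) ^ 2) by nra.
  assert (He : 0 < e).
  { apply Rmin_pos; [lra|]; apply Rdiv_lt_0_compat; [lra|].
    repeat apply Rmult_lt_0_compat; lra. }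
  assert (He1 : e <= 1 / 2) by apply Rmin_l.
  assert (He2 : e * (2 * Cmod (k w) ^ 2 * (INR n + 1)) <= Cmod (k w) ^ 2 - 1).
  { apply Rle_div_r; [|apply Rmin_r]. apply Rlt_gt; repeat apply Rmult_lt_0_compat; lra. }
  assert (Hq : 0 < q <= 1) by (unfold q; lra).
  (* By the Moebius identity [1 - |m z|^2] is [(1 - |w|^2) (1 - rho^2)] over [|1 + conj w z|^2], and
     that denominator is at least [q^2]; this radius makes the quotient at most [e]. *)
  set (rho := 1 - e * q ^ 2 / 4).
  assert (Hq2 : 0 < q ^ 2 <= 1) by (clearbody q; nra).
  assert (Heq : 0 < e * q ^ 2 <= 1 / 2).
  { split; [apply Rmult_lt_0_compat; lra|].
    rewrite <- (Rmult_1_r (1 / 2)); apply Rmult_le_compat; lra. }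
  assert (Hrho : 0 < rho < 1) by (unfold rho; lra).
  assert (Hden : forall z, unit_disc z -> q <= Cmod (1 + Cconj w * z)%C).
  { intros z Hz; generalize (Cmod_triangle_rev 1 (- (Cconj w * z)))%C.
    rewrite Cmod_opp, Cmod_mult, Cmod_conj, Cmod_1.
    replace (1 - - (Cconj w * z))%C with (1 + Cconj w * z)%C by ring.
    unfold unit_disc in Hz; unfold q; pose proof (Cmod_ge_0 z); nra. }
  assert (Hden0 : forall z, unit_disc z -> (1 + Cconj w * z)%C <> 0%C).
  { intros z Hz; apply Cmod_gt_0; specialize (Hden z Hz); lra. }
  set (m := fun z => ((z + w) / (1 + Cconj w * z))%C).
  assert (Hm : forall z, unit_disc z ->
    Cmod (m z) ^ 2 * Cmod (1 + Cconj w * z)%C ^ 2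
      = Cmod (1 + Cconj w * z)%C ^ 2 - (1 - Cmod w ^ 2) * (1 - Cmod z ^ 2)).
  { intros z Hz; rewrite <- moebius_Cmod_identity; unfold m.
    rewrite Cmod_div by auto; field.
    apply Rgt_not_eq; specialize (Hden z Hz); lra. }
  assert (Hmd : forall z, unit_disc z -> unit_disc (m z)).
  { intros z Hz; unfold unit_disc.
    specialize (Hm z Hz); specialize (Hden z Hz); unfold unit_disc in Hz.
    pose proof (Cmod_ge_0 z); pose proof (Cmod_ge_0 (m z)).
    assert (0 < (1 - Cmod w ^ 2) * (1 - Cmod z ^ 2)) by (apply Rmult_lt_0_compat; nra).
    assert (HD : 0 < Cmod (1 + Cconj w * z)%C ^ 2) by (apply pow_lt; lra).
    apply Rnot_le_lt; intros Q.
    assert (1 <= Cmod (m z) ^ 2) by (rewrite <- (pow1 2); apply pow_incr; lra).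
    apply (Rmult_le_compat_r (Cmod (1 + Cconj w * z)%C ^ 2)) in H2; lra. }
  assert (Hk0 : Cmod (k (m 0%C)) <= / (sqrt (1 - e)) ^ n).
  { apply (Cmod_le_circle_bound (fun z => k (m z)) rho); auto.
    - intros z Hz; apply (C_differentiable_comp k m); [auto|].
      apply C_differentiable_div; auto 6 with cdiff.
    - intros z Hz.
      assert (Hzd : unit_disc z) by (unfold unit_disc; lra).
      specialize (Hm z Hzd); specialize (Hden z Hzd).
      assert (Hmz : 1 - e <= Cmod (m z) ^ 2).
      { rewrite Hz in Hm.
        set (D := Cmod (1 + Cconj w * z)%C ^ 2) in *.
        assert (HD : q ^ 2 <= D) by (unfold D; apply pow_incr; lra).
        assert (HD0 : 0 < q ^ 2) by (apply pow_lt; lra).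
        assert (1 - rho ^ 2 <= e * q ^ 2 / 2) by (unfold rho; nra).
        assert (0 <= 1 - Cmod w ^ 2 <= 1) by nra.
        assert ((1 - Cmod w ^ 2) * (1 - rho ^ 2) <= 1 * (e * q ^ 2 / 2)).
        { apply Rmult_le_compat; try lra; nra. }
        apply Rmult_le_reg_r with D; nra. }
      assert (Hs : sqrt (1 - e) <= Cmod (m z)).
      { rewrite <- (sqrt_pow2 (Cmod (m z))) by apply Cmod_ge_0.
        now apply sqrt_le_1_alt. }
      assert (Hs0 : 0 < sqrt (1 - e)) by (apply sqrt_lt_R0; lra).
      assert (Hsn : 0 < sqrt (1 - e) ^ n) by now apply pow_lt.
      apply Rmult_le_reg_r with (sqrt (1 - e) ^ n); auto.
      rewrite Rinv_l by lra.
      eapply Rle_trans; [|apply (Hb (m z)); auto].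
      apply Rmult_le_compat_l; [apply Cmod_ge_0|].
      apply pow_incr; lra. }
  replace (m 0%C) with w in Hk0 by (unfold m; field).
  assert (Hs0 : 0 < sqrt (1 - e)) by (apply sqrt_lt_R0; lra).
  assert (Hsn : 0 < sqrt (1 - e) ^ n) by now apply pow_lt.
  assert (K1 : Cmod (k w) * sqrt (1 - e) ^ n <= 1).
  { apply Rmult_le_reg_r with (/ sqrt (1 - e) ^ n); [now apply Rinv_0_lt_compat|].
    rewrite Rmult_assoc, Rinv_r by lra; lra. }
  assert (K2 : Cmod (k w) ^ 2 * (1 - e) ^ n <= 1).
  { replace (1 - e) with (sqrt (1 - e) * sqrt (1 - e)) by (apply sqrt_sqrt; lra).
    rewrite Rpow_mult_distr.
    replace (Cmod (k w) ^ 2 * (sqrt (1 - e) ^ n * sqrt (1 - e) ^ n))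
      with ((Cmod (k w) * sqrt (1 - e) ^ n) ^ 2) by ring.
    assert (0 <= Cmod (k w) * sqrt (1 - e) ^ n) by (apply Rmult_le_pos; lra).
    nra. }
  assert (Bern : 1 - INR n * e <= (1 - e) ^ n).
  { clear - He He1; clearbody e; induction n as [|n IH]; [simpl; lra|].
    rewrite S_INR; simpl pow; pose proof (pos_INR n).
    assert ((1 - e) * (1 - INR n * e) <= (1 - e) * (1 - e) ^ n)
      by (apply Rmult_le_compat_l; lra).
    assert (0 <= INR n * e * e) by (repeat apply Rmult_le_pos; lra).
    lra. }
  assert (Cmod (k w) ^ 2 * (1 - INR n * e) <= Cmod (k w) ^ 2 * (1 - e) ^ n)
    by (apply Rmult_le_compat_l; lra).
  assert (0 < e * Cmod (k w) ^ 2) by (apply Rmult_lt_0_compat; lra).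
  assert (0 <= e * Cmod (k w) ^ 2 * INR n) by (apply Rmult_le_pos; lra).
  nra.
Qed.

(* [f^(n+2) / z^n] extends differentiably by [0] to the origin (in the expression
   below the junk value at [0] is killed by [f 0 = 0]), so the maximum principle gives
   [|f w|^(n+2) <= |w|^n] without any removable singularity theorem. *)
Theorem schwarz_lemma (f : C -> C) :
  (forall z, unit_disc z -> C_differentiable f z) ->
  (forall z, unit_disc z -> Cmod (f z) <= 1) -> f 0%C = 0%C ->
  forall w, unit_disc w -> Cmod (f w) <= Cmod w.
Proof.
  intros Hf Hb Hf0 w Hw.
  destruct (Ceq_dec w 0%C) as [->|Nw]; [rewrite Hf0; lra|].
  assert (Pw : 0 < Cmod w) by now apply Cmod_gt_0.
  assert (U : forall n, Cmod (f w * f w * (f w / w) ^ n)%C <= 1).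
  { intros n.
    apply (disc_max_principle (fun z => f z * f z * (f z / z) ^ n)%C n); auto.
    - intros z Hz; destruct (Ceq_dec z 0%C) as [->|Nz]; [|auto 6 with cdiff].
      exists 0%C; destruct (Hf 0%C Hz) as [l Hl]; intros eps Heps.
      destruct (Hl 1 Rlt_0_1) as (d & Hd & K).
      (* Near the origin [|f z| <= L |z|], so the whole expression is at most [L^2 L^n |z|^2], which
         gives the derivative [0]. *)
      set (L := Cmod l + 1); pose proof (Cmod_ge_0 l).
      assert (HL : 0 < L) by (unfold L; lra).
      assert (HLn : 0 < L * L * L ^ n) by (repeat apply Rmult_lt_0_compat; auto; now apply pow_lt).
      exists (Rmin d (eps / (L * L * L ^ n))); split.
      { apply Rmin_pos; auto; now apply Rdiv_lt_0_compat. }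
      intros z Hzd.
      rewrite Hf0.
      replace (f z * f z * (f z / z) ^ n - 0 * 0 * (0 / 0) ^ n - 0 * (z - 0))%C
        with (f z * f z * (f z / z) ^ n)%C by ring.
      assert (Z1 := K z (Rlt_le_trans _ _ _ Hzd (Rmin_l _ _))).
      assert (Z2 := Rlt_le_trans _ _ _ Hzd (Rmin_r _ _)).
      rewrite Hf0 in Z1.
      replace (z - 0)%C with z in * by ring.
      assert (Z3 : Cmod (f z) <= L * Cmod z).
      { generalize (Cmod_triangle (f z - 0 - l * z) (l * z)); rewrite Cmod_mult.
        replace (f z - 0 - l * z + l * z)%C with (f z) by ring; unfold L; lra. }
      destruct (Ceq_dec z 0%C) as [->|Nz].
      { rewrite Hf0, !Cmod_mult, Cmod_0; lra. }
      assert (Pz : 0 < Cmod z) by now apply Cmod_gt_0.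
      rewrite !Cmod_mult, Cmod_pow, Cmod_div by auto.
      assert (Z4 : (Cmod (f z) / Cmod z) ^ n <= L ^ n).
      { apply pow_incr; split.
        - apply Rle_div_r; [lra | rewrite Rmult_0_l; apply Cmod_ge_0].
        - apply Rle_div_l; lra. }
      apply Rlt_div_r in Z2; auto.
      pose proof (Cmod_ge_0 (f z)).
      assert (Z5 : Cmod (f z) * Cmod (f z) <= (L * Cmod z) * (L * Cmod z))
        by (apply Rmult_le_compat; auto).
      apply Rle_trans with ((L * Cmod z) * (L * Cmod z) * L ^ n).
      + apply Rmult_le_compat; auto; [nra|].
        apply pow_le, Rle_div_r; [lra | rewrite Rmult_0_l; auto].
      + replace (L * Cmod z * (L * Cmod z) * L ^ n)
          with (Cmod z * (L * L * L ^ n) * Cmod z) by ring.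
        apply Rmult_le_compat_r; lra.
    - intros z Hz; specialize (Hb z Hz); pose proof (Cmod_ge_0 (f z)).
      destruct (Ceq_dec z 0%C) as [->|Nz].
      { rewrite Hf0, !Cmod_mult, Cmod_0; lra. }
      assert (Pz : 0 < Cmod z) by now apply Cmod_gt_0.
      rewrite !Cmod_mult, Cmod_pow, Cmod_div by auto.
      rewrite Rmult_assoc, <- Rpow_mult_distr.
      replace (Cmod (f z) / Cmod z * Cmod z) with (Cmod (f z)) by (field; lra).
      assert (0 <= Cmod (f z) ^ n <= 1).
      { split; [now apply pow_le|]; rewrite <- (pow1 n); apply pow_incr; lra. }
      nra. }
  (* [U] says that [|f w|^2 q^n <= 1] for every [n], with [q = |f w| / |w|]; a ratio [q > 1] would
     make these powers unbounded. *)
  destruct (Rle_lt_dec (Cmod (f w)) (Cmod w)) as [L|L]; [exact L|exfalso].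
  set (q := Cmod (f w) / Cmod w).
  assert (Hq : 1 < q) by (apply Rlt_div_r; lra).
  destruct (Pow_x_infinity q ltac:(rewrite Rabs_pos_eq; lra) (/ Cmod (f w) ^ 2 + 1)) as [n Hn].
  specialize (Hn n (Nat.le_refl n)); specialize (U n).
  rewrite Rabs_pos_eq in Hn by (apply pow_le; lra).
  rewrite !Cmod_mult, Cmod_pow, Cmod_div in U by auto; fold q in U.
  assert (P : 0 < Cmod (f w) ^ 2) by (apply pow_lt; lra).
  apply Rge_le, (Rmult_le_compat_l (Cmod (f w) ^ 2)) in Hn; [|lra].
  rewrite Rmult_plus_distr_l, Rinv_r in Hn by lra.
  nra.
Qed.

(** * Inequalities for points of the closed tetrablock *)

Lemma Cmod_quotient_identity_l (x1 x2 x3 : C) :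
  Cmod (x1 - Cconj x2 * x3)%C ^ 2 - Cmod (x1 * x2 - x3)%C ^ 2
    = (1 - Cmod x2 ^ 2) * (Cmod x1 ^ 2 - Cmod x3 ^ 2).
Proof. rewrite !Cmod2_Re_Im; unfold Re, Im; simpl; ring. Qed.

Lemma Cmod_quotient_identity_r (x1 x2 x3 : C) :
  Cmod (x2 - Cconj x1 * x3)%C ^ 2 - Cmod (x1 * x2 - x3)%C ^ 2
    = (1 - Cmod x1 ^ 2) * (Cmod x2 ^ 2 - Cmod x3 ^ 2).
Proof. rewrite !Cmod2_Re_Im; unfold Re, Im; simpl; ring. Qed.

Lemma Cmod_sub_mult_ge (x y z : C) : Rabs (Cmod x - Cmod y * Cmod z) <= Cmod (x - y * z)%C.
Proof.
  rewrite <- Cmod_mult; apply Rabs_le.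
  generalize (Cmod_triangle_rev x (y * z)), (Cmod_triangle_rev (y * z) x).
  rewrite (Cmod_minus_sym (y * z)); lra.
Qed.

(** In the lemmas [moduli_*], [a1, a2, a3] are the moduli of [x1, x2, x3], and [sA], [sB], [h] those
    of [x1 - x2^* x3], [x2 - x1^* x3] and [x1 x2 - x3]. *)
Lemma moduli_9_3 (a1 a2 a3 sA h : R) :
  0 <= a1 -> 0 <= a2 < 1 -> 0 <= a3 -> 0 <= sA -> 0 <= h ->
  sA ^ 2 - h ^ 2 = (1 - a2 ^ 2) * (a1 ^ 2 - a3 ^ 2) ->
  Rabs (a3 - a1 * a2) <= h ->
  a3 <= 1 -> a1 ^ 2 + a2 ^ 2 - a3 ^ 2 + 2 * h <= 1 -> sA + h <= 1 - a2 ^ 2.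
Proof.
  intros H1 H2 H3 HA Hh HI Th H3' H.
  apply Rabs_le_between in Th.
  assert (P : 0 < 1 - a2 ^ 2) by nra.
  (* With [H] this gives [(1 - (a1^2 + h)) (1 - (a2^2 + h)) >= 0]. The two factors have nonnegative
     sum because [a3 <= 1], so the second cannot be negative. *)
  assert (Had : a3 ^ 2 <= (a1 ^ 2 + h) * (a2 ^ 2 + h)).
  { assert (a3 ^ 2 <= (a1 * a2 + h) ^ 2) by (apply pow_incr; lra).
    assert (0 <= h * (a1 - a2) ^ 2) by (apply Rmult_le_pos; [lra | apply pow2_ge_0]).
    nra. }
  assert (Hh1 : h <= 1 - a2 ^ 2).
  { apply Rnot_lt_le; intros L.
    assert (0 <= (1 - (a1 ^ 2 + h)) * (1 - (a2 ^ 2 + h))) by lra.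
    assert (a1 ^ 2 + h < 1) by nra.
    assert (0 < (1 - (a1 ^ 2 + h)) * (a2 ^ 2 + h - 1)) by (apply Rmult_lt_0_compat; lra).
    lra. }
  (* Substituting the identity for [sA^2] and dividing by [1 - a2^2] leaves exactly [H]. *)
  assert (K : sA ^ 2 <= (1 - a2 ^ 2 - h) ^ 2) by nra.
  assert (sA <= 1 - a2 ^ 2 - h) by (apply Rsqr_incr_0_var; [unfold Rsqr; nra | lra]).
  lra.
Qed.

(** Replacing [sB] by its lower bound [a2 - a1 a3] turns the hypothesis into
    [(a1 - a3)^2 <= (1 - a2)^2]. If [a3 > 1], the hypothesis also gives [a1 < a2], which contradicts
    this. *)
Lemma moduli_6_le (a1 a2 a3 sB : R) :
  0 <= a1 -> 0 <= a2 < 1 -> 0 <= a3 -> Rabs (a2 - a1 * a3) <= sB ->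
  a1 ^ 2 - a2 ^ 2 + a3 ^ 2 + 2 * sB <= 1 ->
  Rabs (a1 - a3) <= 1 - a2 /\ a3 <= 1.
Proof.
  intros H1 H2 H3 TB H.
  apply Rabs_le_between in TB.
  assert (K : Rabs (a1 - a3) <= 1 - a2).
  { assert (Rsqr (a1 - a3) <= Rsqr (1 - a2)) by (unfold Rsqr; nra).
    apply Rsqr_le_abs_0 in H0; rewrite (Rabs_pos_eq (1 - a2)) in H0; lra. }
  split; auto.
  apply Rabs_le_between in K.
  apply Rnot_lt_le; intros L.
  assert (a1 ^ 2 < a2 ^ 2) by nra.
  assert (a1 < a2) by nra.
  lra.
Qed.

(** Squaring the hypothesis and subtracting four times the identity gives
    [(2 h)^2 <= (1 - a1^2 - a2^2 + a3^2)^2], so only the sign of the right-hand base is at stake.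
    Were it negative, the two lower bounds on [h] would yield [1 + a3 <= a1 + a2] and
    [1 - a3 <= |a1 - a2|], which [moduli_6_le] and [a2 < 1] exclude. *)
Lemma moduli_6_9 (a1 a2 a3 sB h : R) :
  0 <= a1 -> 0 <= a2 < 1 -> 0 <= a3 -> 0 <= sB -> 0 <= h ->
  sB ^ 2 - h ^ 2 = (1 - a1 ^ 2) * (a2 ^ 2 - a3 ^ 2) ->
  Rabs (a2 - a1 * a3) <= sB -> Rabs (a3 - a1 * a2) <= h ->
  a1 ^ 2 - a2 ^ 2 + a3 ^ 2 + 2 * sB <= 1 ->
  a3 <= 1 /\ a1 ^ 2 + a2 ^ 2 - a3 ^ 2 + 2 * h <= 1.
Proof.
  intros H1 H2 H3 HB Hh HI TB Th H.
  destruct (moduli_6_le a1 a2 a3 sB) as [K K3]; auto.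
  split; auto.
  apply Rabs_le_between in TB, Th, K.
  assert (Q : Rsqr (2 * h) <= Rsqr (1 - a1 ^ 2 - (a2 ^ 2 - a3 ^ 2))).
  { assert ((2 * sB) ^ 2 <= (1 - a1 ^ 2 + (a2 ^ 2 - a3 ^ 2)) ^ 2) by (apply pow_incr; lra).
    unfold Rsqr; nra. }
  apply Rsqr_le_abs_0 in Q; rewrite (Rabs_pos_eq (2 * h)) in Q by lra.
  destruct (Rle_lt_dec 0 (1 - a1 ^ 2 - (a2 ^ 2 - a3 ^ 2))) as [S|S];
    [rewrite Rabs_pos_eq in Q by lra; lra | exfalso; rewrite Rabs_left in Q by lra].
  assert (L1 : a3 ^ 2 < a2 ^ 2 \/ a2 ^ 2 <= a3 ^ 2) by lra.
  destruct L1 as [L1|L1]; [|nra].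
  assert (L : a3 < a2) by nra.
  assert (R1 : (1 - a3) ^ 2 <= (a1 - a2) ^ 2) by nra.
  assert (R2 : (1 + a3) ^ 2 <= (a1 + a2) ^ 2) by nra.
  assert (R3 : 1 + a3 <= a1 + a2).
  { apply Rsqr_incr_0; [unfold Rsqr; nra | lra | lra]. }
  destruct (Rle_lt_dec a2 a1) as [M|M].
  - assert (1 - a3 <= a1 - a2) by (apply Rsqr_incr_0; [unfold Rsqr; nra | lra | lra]).
    lra.
  - assert (1 - a3 <= a2 - a1) by (apply Rsqr_incr_0; [unfold Rsqr; nra | lra | lra]).
    lra.
Qed.

(** By the identity, [sA^2 <= (1 - a3^2 - sB)^2] divided by [1 - a3^2] is the first inequality. What
    remains is the degenerate case [a3 = 1] and the sign of [1 - a3^2 - sB]. *)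
Lemma moduli_6_8 (a1 a2 a3 sA sB : R) :
  0 <= a1 -> 0 <= a2 < 1 -> 0 <= a3 -> 0 <= sA -> 0 <= sB ->
  sA ^ 2 - sB ^ 2 = (a1 ^ 2 - a2 ^ 2) * (1 - a3 ^ 2) ->
  Rabs (a1 - a2 * a3) <= sA -> Rabs (a2 - a1 * a3) <= sB ->
  (a1 ^ 2 - a2 ^ 2 + a3 ^ 2 + 2 * sB <= 1 <-> sA + sB + a3 ^ 2 <= 1).
Proof.
  intros H1 H2 H3 HA HB HI TA TB; split; intros H.
  - destruct (moduli_6_le a1 a2 a3 sB) as [K K3]; auto.
    apply Rabs_le_between in TA, TB, K.
    destruct (Req_dec a3 1) as [->|N].
    + assert (a1 <= a2) by nra.
      assert (a1 = a2) by nra; subst a2.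
      assert (sB = 0) by lra; subst sB.
      nra.
    + assert (L3 : a3 ^ 2 < 1) by nra.
      assert (Q : sB <= 1 - a3 ^ 2).
      { apply Rnot_lt_le; intros L.
        assert (Q : Rsqr (2 * sA) <= Rsqr ((a2 ^ 2 - a1 ^ 2) - (1 - a3 ^ 2))).
        { assert ((2 * sB) ^ 2 <= ((a2 ^ 2 - a1 ^ 2) + (1 - a3 ^ 2)) ^ 2)
            by (apply pow_incr; lra).
          unfold Rsqr; nra. }
        apply Rsqr_le_abs_0 in Q; rewrite (Rabs_pos_eq (2 * sA)), Rabs_pos_eq in Q by lra.
        assert (1 + a1 <= a2 + a3) by (apply Rsqr_incr_0; [unfold Rsqr; nra | lra | lra]).
        assert ((1 - a1) ^ 2 <= (a2 - a3) ^ 2) by nra.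
        nra. }
      assert (sA ^ 2 <= (1 - a3 ^ 2 - sB) ^ 2) by nra.
      assert (sA <= 1 - a3 ^ 2 - sB) by (apply Rsqr_incr_0; [unfold Rsqr; nra | lra | lra]).
      lra.
  - assert (K3 : a3 ^ 2 <= 1) by lra.
    destruct (Req_dec (a3 ^ 2) 1) as [E|N].
    + assert (sA = 0) by lra; assert (sB = 0) by lra; subst sA sB.
      assert (a3 = 1) by nra; subst a3.
      apply Rabs_le_between in TA, TB; nra.
    + assert (sA ^ 2 <= (1 - a3 ^ 2 - sB) ^ 2) by (apply pow_incr; lra).
      apply Rmult_le_reg_l with (1 - a3 ^ 2); nra.
Qed.

Lemma Cconj_RtoC (r : R) : Cconj (RtoC r) = RtoC r.
Proof. apply injective_projections; simpl; ring. Qed.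

Lemma Cconj_mult_self (z : C) : (Cconj z * z)%C = RtoC (Cmod z ^ 2).
Proof. rewrite Cmod2_conj; ring. Qed.

Lemma exists_aligned (u : C) : exists t : C, Cmod t = 1 /\ (t * u)%C = RtoC (Cmod u).
Proof.
  destruct (Ceq_dec u 0%C) as [->|N].
  - exists 1%C; rewrite Cmod_1, Cmod_0; split; auto; ring.
  - assert (P : 0 < Cmod u) by now apply Cmod_gt_0.
    assert (NR : RtoC (Cmod u) <> 0%C) by (intros Q; apply RtoC_inj in Q; lra).
    exists (Cconj u / RtoC (Cmod u))%C; split.
    + rewrite Cmod_div, Cmod_conj, Cmod_R, Rabs_pos_eq by (auto; lra); field; lra.
    + transitivity ((Cconj u * u) / RtoC (Cmod u))%C; [field; auto|].
      rewrite Cconj_mult_self, RtoC_pow; field; auto.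
Qed.

(** [|Psi(z, x)| <= 1] on the disc, with denominators cleared. *)
Definition Psi_contractive (x1 x2 x3 : C) : Prop :=
  forall z : C, unit_disc z -> Cmod (x3 * z - x1)%C <= Cmod (x2 * z - 1)%C.

(* [Psi(., x)] maps the disc into the disc of centre [(x1 - x2^* x3) / (1 - |x2|^2)]
   and radius [|x1 x2 - x3| / (1 - |x2|^2)]. *)
Lemma Psi_contractive_of_3 (x1 x2 x3 : C) : Cmod x2 < 1 ->
  Cmod (x1 - Cconj x2 * x3)%C + Cmod (x1 * x2 - x3)%C <= 1 - Cmod x2 ^ 2 ->
  Psi_contractive x1 x2 x3.
Proof.
  intros H2 H z Hz; unfold unit_disc in Hz.
  pose proof (Cmod_ge_0 x2) as P2.
  assert (P : 0 < 1 - Cmod x2 ^ 2) by nra.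
  rewrite (Cmod_minus_sym (x3 * z)), (Cmod_minus_sym (x2 * z)).
  (* Centre plus off-centre term: divided by [(1 - |x2|^2) (1 - x2 z)], the last summand is a
     constant of modulus equal to the radius times the disc automorphism
     [(conj x2 - z) / (1 - x2 z)], whose modulus [B] bounds by one. *)
  assert (E : (RtoC (1 - Cmod x2 ^ 2) * (x1 - x3 * z)
    = (x1 - Cconj x2 * x3) * (1 - x2 * z) + (Cconj x2 - z) * (x3 - x1 * x2))%C).
  { rewrite RtoC_minus, <- Cconj_mult_self; ring. }
  assert (B : Cmod (Cconj x2 - z)%C <= Cmod (1 - x2 * z)%C).
  { apply Rsqr_incr_0_var; [|apply Cmod_ge_0].
    generalize (moebius_Cmod_identity (- Cconj x2) z).
    replace (Cconj (- Cconj x2)) with (- x2)%C by now rewrite Copp_conj, Cconj_conj.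
    replace (1 + - x2 * z)%C with (1 - x2 * z)%C by ring.
    replace (z + - Cconj x2)%C with (z - Cconj x2)%C by ring.
    rewrite (Cmod_minus_sym (Cconj x2)), Cmod_opp, Cmod_conj; unfold Rsqr.
    pose proof (Cmod_ge_0 z).
    assert (0 <= (1 - Cmod x2 ^ 2) * (1 - Cmod z ^ 2)) by (apply Rmult_le_pos; nra).
    lra. }
  apply Rmult_le_reg_l with (1 - Cmod x2 ^ 2); auto.
  rewrite <- (Rabs_pos_eq (1 - Cmod x2 ^ 2)) at 1 by lra.
  rewrite <- Cmod_R, <- Cmod_mult, E.
  eapply Rle_trans; [apply Cmod_triangle|]; rewrite !Cmod_mult.
  rewrite (Cmod_minus_sym x3).
  pose proof (Cmod_ge_0 (x1 * x2 - x3)); pose proof (Cmod_ge_0 (1 - x2 * z)).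
  assert (Cmod (Cconj x2 - z) * Cmod (x1 * x2 - x3)
          <= Cmod (1 - x2 * z) * Cmod (x1 * x2 - x3)) by (apply Rmult_le_compat_r; lra).
  apply (Rmult_le_compat_r (Cmod (1 - x2 * z))) in H; lra.
Qed.

(** Radial limit: moving from [z] to [(1 - t) z] changes the two sides by at most [t (|x3| + |x2|)]
    together, less than the gap [g]. *)
Lemma Psi_contractive_circle (x1 x2 x3 z : C) : Psi_contractive x1 x2 x3 -> Cmod z = 1 ->
  Cmod (x3 * z - x1)%C <= Cmod (x2 * z - 1)%C.
Proof.
  intros H Hz; apply Rnot_lt_le; intros L.
  set (g := Cmod (x3 * z - x1) - Cmod (x2 * z - 1)).
  set (M := Cmod x3 + Cmod x2 + 1).
  pose proof (Cmod_ge_0 x3); pose proof (Cmod_ge_0 x2).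
  set (t := Rmin (1 / 2) (g / (2 * M))).
  assert (Hg : 0 < g) by (unfold g; lra).
  assert (HM : 0 < M) by (unfold M; lra).
  assert (Ht : 0 < t).
  { apply Rmin_pos; [lra | apply Rdiv_lt_0_compat; lra]. }
  assert (Ht1 : t <= 1 / 2) by apply Rmin_l.
  assert (Ht2 : t * (2 * M) <= g) by (apply Rle_div_r; [lra | apply Rmin_r]).
  assert (D : unit_disc (RtoC (1 - t) * z)%C).
  { unfold unit_disc; rewrite Cmod_mult, Cmod_R, Hz, Rabs_pos_eq; lra. }
  apply H in D; revert D; apply Rlt_not_le.
  assert (Q : forall c, Cmod (c * (RtoC t * z))%C = Cmod c * t).
  { intros c; rewrite !Cmod_mult, Cmod_R, Hz, (Rabs_pos_eq t); lra. }
  generalize (Cmod_triangle_rev (x3 * z - x1) (x3 * (RtoC t * z))).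
  generalize (Cmod_triangle_minus (x2 * z - 1) (x2 * (RtoC t * z))).
  rewrite !Q, RtoC_minus.
  replace (x3 * z - x1 - x3 * (t * z))%C with (x3 * ((1 - t) * z) - x1)%C by ring.
  replace (x2 * z - 1 - x2 * (t * z))%C with (x2 * ((1 - t) * z) - 1)%C by ring.
  unfold g, M in *; nra.
Qed.

(** On the unit circle the difference of the squared sides is affine in [Re (t (x2 - conj x1 x3))];
    the inequality is read off at the [t] that makes this term as large as possible. *)
Lemma Psi_contractive_6 (x1 x2 x3 : C) : Psi_contractive x1 x2 x3 ->
  Cmod x1 ^ 2 - Cmod x2 ^ 2 + Cmod x3 ^ 2 + 2 * Cmod (x2 - Cconj x1 * x3)%C <= 1.
Proof.
  intros H.
  destruct (exists_aligned (x2 - Cconj x1 * x3)) as (t & Ht & Et).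
  generalize (Psi_contractive_circle _ _ _ t H Ht); intros K.
  apply (conj (Cmod_ge_0 _)), (pow_incr _ _ 2) in K.
  assert (E : Cmod (x3 * t - x1)%C ^ 2 - Cmod (x2 * t - 1)%C ^ 2
    = Cmod x1 ^ 2 + Cmod x3 ^ 2 * Cmod t ^ 2 - Cmod x2 ^ 2 * Cmod t ^ 2 - 1
      + 2 * Re (t * (x2 - Cconj x1 * x3))%C).
  { rewrite !Cmod2_Re_Im; unfold Re, Im; simpl; ring. }
  rewrite Et, re_RtoC, Ht in E; lra.
Qed.

(** * Closed forms of the inequality for [Psi], with [lambda0] scaled away *)

Section normalized.

Variables x1 x2 x3 : C.
Hypothesis Hx2 : Cmod x2 < 1.

Let P1 := Cmod_ge_0 x1.
Let P2 := Cmod_ge_0 x2.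
Let P3 := Cmod_ge_0 x3.
Let PA := Cmod_ge_0 (x1 - Cconj x2 * x3)%C.
Let PB := Cmod_ge_0 (x2 - Cconj x1 * x3)%C.
Let Ph := Cmod_ge_0 (x1 * x2 - x3)%C.

Let TA : Rabs (Cmod x1 - Cmod x2 * Cmod x3) <= Cmod (x1 - Cconj x2 * x3)%C.
Proof. rewrite <- (Cmod_conj x2); apply Cmod_sub_mult_ge. Qed.

Let TB : Rabs (Cmod x2 - Cmod x1 * Cmod x3) <= Cmod (x2 - Cconj x1 * x3)%C.
Proof. rewrite <- (Cmod_conj x1); apply Cmod_sub_mult_ge. Qed.

Let Th : Rabs (Cmod x3 - Cmod x1 * Cmod x2) <= Cmod (x1 * x2 - x3)%C.
Proof. rewrite (Cmod_minus_sym (x1 * x2)); apply Cmod_sub_mult_ge. Qed.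

Lemma condition_6_9 :
  Cmod x1 ^ 2 - Cmod x2 ^ 2 + Cmod x3 ^ 2 + 2 * Cmod (x2 - Cconj x1 * x3)%C <= 1 ->
  Cmod x3 <= 1 /\
  Cmod x1 ^ 2 + Cmod x2 ^ 2 - Cmod x3 ^ 2 + 2 * Cmod (x1 * x2 - x3)%C <= 1.
Proof.
  apply moduli_6_9; auto; apply Cmod_quotient_identity_r.
Qed.

Lemma condition_9_3 :
  Cmod x3 <= 1 /\
  Cmod x1 ^ 2 + Cmod x2 ^ 2 - Cmod x3 ^ 2 + 2 * Cmod (x1 * x2 - x3)%C <= 1 ->
  Cmod (x1 - Cconj x2 * x3)%C + Cmod (x1 * x2 - x3)%C <= 1 - Cmod x2 ^ 2.
Proof.
  intros [H3 H]; apply (moduli_9_3 (Cmod x1) _ (Cmod x3)); auto.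
  apply Cmod_quotient_identity_l.
Qed.

Lemma Psi_contractive_iff_3 : Psi_contractive x1 x2 x3 <->
  Cmod (x1 - Cconj x2 * x3)%C + Cmod (x1 * x2 - x3)%C <= 1 - Cmod x2 ^ 2.
Proof.
  split.
  - intros H; apply condition_9_3, condition_6_9, Psi_contractive_6, H.
  - now apply Psi_contractive_of_3.
Qed.

Lemma Psi_contractive_iff_6 : Psi_contractive x1 x2 x3 <->
  Cmod x1 ^ 2 - Cmod x2 ^ 2 + Cmod x3 ^ 2 + 2 * Cmod (x2 - Cconj x1 * x3)%C <= 1.
Proof.
  split; [apply Psi_contractive_6|].
  intros H; apply Psi_contractive_iff_3, condition_9_3, condition_6_9, H.
Qed.

Lemma Psi_contractive_iff_9 : Psi_contractive x1 x2 x3 <->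
  Cmod x3 <= 1 /\
  Cmod x1 ^ 2 + Cmod x2 ^ 2 - Cmod x3 ^ 2 + 2 * Cmod (x1 * x2 - x3)%C <= 1.
Proof.
  split.
  - intros H; apply condition_6_9, Psi_contractive_6, H.
  - intros H; apply Psi_contractive_iff_3, condition_9_3, H.
Qed.

Lemma Psi_contractive_iff_8 : Psi_contractive x1 x2 x3 <->
  Cmod (x1 - Cconj x2 * x3)%C + Cmod (x2 - Cconj x1 * x3)%C + Cmod x3 ^ 2 <= 1.
Proof.
  rewrite Psi_contractive_iff_6; apply moduli_6_8; auto.
  generalize (Cmod_quotient_identity_l x1 x2 x3), (Cmod_quotient_identity_r x1 x2 x3); nra.
Qed.

(** The expression is affine in [z], and its root is the reciprocal of [Psi(w, x)]: a root in the
    open disc means [|Psi(w, x)| > 1]. *)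
Lemma Psi_contractive_iff_7 : Psi_contractive x1 x2 x3 <->
  forall z w, unit_disc z -> unit_disc w -> (1 - x1 * z - x2 * w + x3 * z * w)%C <> 0%C.
Proof.
  assert (N : forall w, unit_disc w -> (1 - x2 * w)%C <> 0%C).
  { intros w Hw; unfold unit_disc in Hw; apply one_minus_neq_0; lra. }
  split.
  - intros H z w Hz Hw E; apply (N w Hw), Cmod_eq_0.
    assert (E' : (1 - x2 * w)%C = (z * (x1 - x3 * w))%C).
    { replace (1 - x2 * w)%C
        with ((1 - x1 * z - x2 * w + x3 * z * w) + z * (x1 - x3 * w))%C by ring.
      rewrite E; ring. }
    specialize (H w Hw); rewrite Cmod_minus_sym, (Cmod_minus_sym (x2 * w)) in H.
    assert (E2 : Cmod (1 - x2 * w) = Cmod z * Cmod (x1 - x3 * w))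
      by (rewrite E', Cmod_mult; reflexivity).
    unfold unit_disc in Hz.
    pose proof (Cmod_ge_0 z); pose proof (Cmod_ge_0 (1 - x2 * w)).
    pose proof (Cmod_ge_0 (x1 - x3 * w)); nra.
  - intros H w Hw; rewrite Cmod_minus_sym, (Cmod_minus_sym (x2 * w)).
    apply Rnot_lt_le; intros L.
    pose proof (Cmod_ge_0 (1 - x2 * w)).
    assert (N1 : (x1 - x3 * w)%C <> 0%C) by (apply Cmod_gt_0; lra).
    apply (H ((1 - x2 * w) / (x1 - x3 * w))%C w); auto.
    + unfold unit_disc; rewrite Cmod_div by auto.
      apply Rlt_div_l; lra.
    + field; auto.
Qed.

(** The equations are equivalent, for [|x3| < 1], to [x1 - conj x2 x3 = b1 (1 - |x3|^2)] and
    [x2 - conj x1 x3 = b2 (1 - |x3|^2)]. Thus [|b1| + |b2| <= 1] is the inequality of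
    [Psi_contractive_iff_8] divided by [1 - |x3|^2]. *)
Lemma Psi_contractive_iff_10 : Psi_contractive x1 x2 x3 <->
  Cmod x3 <= 1 /\ exists b1 b2 : C, Cmod b1 + Cmod b2 <= 1 /\
    x1 = (b1 + Cconj b2 * x3)%C /\ x2 = (b2 + Cconj b1 * x3)%C.
Proof.
  rewrite Psi_contractive_iff_8; split.
  - intros H.
    assert (H3 : Cmod x3 <= 1) by nra.
    split; auto.
    destruct (Req_dec (Cmod x3) 1) as [E|N].
    + rewrite E in H.
      (* For [|x3| = 1] the system is degenerate, but both differences vanish; then
         [x1 = conj x2 x3] has modulus [|x2| < 1] and can serve as [b1]. *)
      exists x1, 0%C; rewrite Cmod_0, (Cconj_RtoC 0).
      assert (A0 : (x1 - Cconj x2 * x3)%C = 0%C) by (apply Cmod_eq_0; lra).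
      assert (B0 : (x2 - Cconj x1 * x3)%C = 0%C) by (apply Cmod_eq_0; lra).
      repeat split.
      * replace x1 with ((x1 - Cconj x2 * x3) + Cconj x2 * x3)%C by ring.
        rewrite A0, Cplus_0_l, Cmod_mult, Cmod_conj, E; lra.
      * ring.
      * replace x2 with ((x2 - Cconj x1 * x3) + Cconj x1 * x3)%C at 1 by ring.
        now rewrite B0.
    + set (g := 1 - Cmod x3 ^ 2).
      assert (Hg : 0 < g) by (unfold g; nra).
      assert (NR : RtoC g <> 0%C) by (intros Q; apply RtoC_inj in Q; lra).
      assert (Eg : RtoC g = (1 - x3 * Cconj x3)%C)
        by (unfold g; rewrite RtoC_minus, Cmod2_conj; reflexivity).
      exists ((x1 - Cconj x2 * x3) / RtoC g)%C, ((x2 - Cconj x1 * x3) / RtoC g)%C.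
      rewrite !Cmod_div, Cmod_R, Rabs_pos_eq by (auto; lra).
      split; [|split].
      * rewrite <- Rdiv_plus_distr; apply Rle_div_l; unfold g in *; lra.
      * rewrite Cdiv_conj, Cminus_conj, Cmult_conj, Cconj_conj, Cconj_RtoC by auto.
        rewrite Eg in *; field; auto.
      * rewrite Cdiv_conj, Cminus_conj, Cmult_conj, Cconj_conj, Cconj_RtoC by auto.
        rewrite Eg in *; field; auto.
  - intros (H3 & b1 & b2 & Hb & E1 & E2).
    assert (Hg : 0 <= 1 - Cmod x3 ^ 2) by nra.
    replace (x1 - Cconj x2 * x3)%C with (b1 * RtoC (1 - Cmod x3 ^ 2))%C.
    2:{ rewrite E1, E2, Cplus_conj, Cmult_conj, Cconj_conj, RtoC_minus, Cmod2_conj; ring. }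
    replace (x2 - Cconj x1 * x3)%C with (b2 * RtoC (1 - Cmod x3 ^ 2))%C.
    2:{ rewrite E1, E2, Cplus_conj, Cmult_conj, Cconj_conj, RtoC_minus, Cmod2_conj; ring. }
    rewrite !Cmod_mult, Cmod_R, Rabs_pos_eq by auto; nra.
Qed.

End normalized.

(** [|Psi(z, x)| <= |l|] on the disc, with denominators cleared. *)
Definition Psi_le (l x1 x2 x3 : C) : Prop :=
  forall z : C, unit_disc z -> Cmod (x3 * z - x1)%C <= Cmod l * Cmod (x2 * z - 1)%C.

Lemma exists_Cmult_eq (l a : C) : l <> 0%C -> exists y, a = (l * y)%C.
Proof. intros Hl; exists (a / l)%C; field; auto. Qed.

(** The numerator of [Psi] scales with the first and third coordinates and [b] stays fixed, whence
    the factors [|l|^2] on [b] in the closed forms below. *)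
Lemma Psi_le_scal (l y1 b y3 : C) : l <> 0%C ->
  Psi_le l (l * y1)%C b (l * y3)%C <-> Psi_contractive y1 b y3.
Proof.
  intros Hl; assert (P : 0 < Cmod l) by now apply Cmod_gt_0.
  split; intros H z Hz; specialize (H z Hz).
  - replace (l * y3 * z - l * y1)%C with (l * (y3 * z - y1))%C in H by ring.
    rewrite Cmod_mult in H; now apply Rmult_le_reg_l in H.
  - replace (l * y3 * z - l * y1)%C with (l * (y3 * z - y1))%C by ring.
    rewrite Cmod_mult; apply Rmult_le_compat_l; lra.
Qed.

Lemma Psi_le_iff_3 (l a b p : C) : l <> 0%C -> Cmod b < 1 ->
  Psi_le l a b p <->
  (Cmod (a - Cconj b * p)%C + Cmod (a * b - p)%C) / (1 - Cmod b ^ 2) <= Cmod l.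
Proof.
  intros Hl Hb; assert (P : 0 < Cmod l) by now apply Cmod_gt_0.
  pose proof (Cmod_ge_0 b).
  destruct (exists_Cmult_eq l a Hl) as [y1 ->], (exists_Cmult_eq l p Hl) as [y3 ->].
  rewrite Psi_le_scal, Psi_contractive_iff_3 by auto.
  replace (l * y1 - Cconj b * (l * y3))%C with (l * (y1 - Cconj b * y3))%C by ring.
  replace (l * y1 * b - l * y3)%C with (l * (y1 * b - y3))%C by ring.
  rewrite !Cmod_mult, Rle_div_l by nra.
  rewrite <- Rmult_plus_distr_l; split; intros K.
  - apply Rmult_le_compat_l; lra.
  - now apply Rmult_le_reg_l in K.
Qed.

Lemma Psi_le_iff_6 (l a b p : C) : l <> 0%C -> Cmod b < 1 ->
  Psi_le l a b p <->
  Cmod a ^ 2 - Cmod l ^ 2 * Cmod b ^ 2 + Cmod p ^ 2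
    + 2 * Cmod (RtoC (Cmod l ^ 2) * b - Cconj a * p)%C <= Cmod l ^ 2.
Proof.
  intros Hl Hb; assert (P : 0 < Cmod l) by now apply Cmod_gt_0.
  destruct (exists_Cmult_eq l a Hl) as [y1 ->], (exists_Cmult_eq l p Hl) as [y3 ->].
  rewrite Psi_le_scal, Psi_contractive_iff_6 by auto.
  replace (RtoC (Cmod l ^ 2) * b - Cconj (l * y1) * (l * y3))%C
    with (RtoC (Cmod l ^ 2) * (b - Cconj y1 * y3))%C
    by (rewrite Cmod2_conj, Cmult_conj; ring).
  assert (P2 : 0 < Cmod l ^ 2) by now apply pow_lt.
  rewrite !Cmod_mult, Cmod_R, (Rabs_pos_eq (Cmod l ^ 2)), !Rpow_mult_distr by lra.
  split; intros K.
  - apply (Rmult_le_compat_l (Cmod l ^ 2)) in K; lra.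
  - apply Rmult_le_reg_l with (Cmod l ^ 2); lra.
Qed.

Lemma Psi_le_iff_7 (l a b p : C) : l <> 0%C -> Cmod b < 1 ->
  Psi_le l a b p <->
  forall z w : C, unit_disc z -> unit_disc w ->
    (l - a * z - b * l * w + p * z * w)%C <> 0%C.
Proof.
  intros Hl Hb.
  destruct (exists_Cmult_eq l a Hl) as [y1 ->], (exists_Cmult_eq l p Hl) as [y3 ->].
  rewrite Psi_le_scal, Psi_contractive_iff_7 by auto.
  split; intros K z w Hz Hw E; apply (K z w Hz Hw).
  - replace (1 - y1 * z - b * w + y3 * z * w)%C
      with ((l - l * y1 * z - b * l * w + l * y3 * z * w) / l)%C by (field; auto).
    rewrite E; unfold Cdiv; ring.
  - replace (l - l * y1 * z - b * l * w + l * y3 * z * w)%C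
      with (l * (1 - y1 * z - b * w + y3 * z * w))%C by ring.
    rewrite E; ring.
Qed.

Lemma Psi_le_iff_8 (l a b p : C) : l <> 0%C -> Cmod b < 1 ->
  Psi_le l a b p <->
  Cmod l * Cmod (a - Cconj b * p)%C
    + Cmod (RtoC (Cmod l ^ 2) * b - Cconj a * p)%C + Cmod p ^ 2 <= Cmod l ^ 2.
Proof.
  intros Hl Hb; assert (P : 0 < Cmod l) by now apply Cmod_gt_0.
  destruct (exists_Cmult_eq l a Hl) as [y1 ->], (exists_Cmult_eq l p Hl) as [y3 ->].
  rewrite Psi_le_scal, Psi_contractive_iff_8 by auto.
  replace (l * y1 - Cconj b * (l * y3))%C with (l * (y1 - Cconj b * y3))%C by ring.
  replace (RtoC (Cmod l ^ 2) * b - Cconj (l * y1) * (l * y3))%C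
    with (RtoC (Cmod l ^ 2) * (b - Cconj y1 * y3))%C
    by (rewrite Cmod2_conj, Cmult_conj; ring).
  assert (P2 : 0 < Cmod l ^ 2) by now apply pow_lt.
  rewrite !Cmod_mult, Cmod_R, (Rabs_pos_eq (Cmod l ^ 2)), !Rpow_mult_distr by lra.
  split; intros K.
  - apply (Rmult_le_compat_l (Cmod l ^ 2)) in K; lra.
  - apply Rmult_le_reg_l with (Cmod l ^ 2); lra.
Qed.

Lemma Psi_le_iff_9 (l a b p : C) : l <> 0%C -> Cmod b < 1 ->
  Psi_le l a b p <->
  Cmod p <= Cmod l /\
  Cmod a ^ 2 + Cmod (l * b)%C ^ 2 - Cmod p ^ 2 + 2 * Cmod l * Cmod (a * b - p)%C
    <= Cmod l ^ 2.
Proof.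
  intros Hl Hb; assert (P : 0 < Cmod l) by now apply Cmod_gt_0.
  destruct (exists_Cmult_eq l a Hl) as [y1 ->], (exists_Cmult_eq l p Hl) as [y3 ->].
  rewrite Psi_le_scal, Psi_contractive_iff_9 by auto.
  replace (l * y1 * b - l * y3)%C with (l * (y1 * b - y3))%C by ring.
  assert (P2 : 0 < Cmod l ^ 2) by now apply pow_lt.
  rewrite !Cmod_mult, !Rpow_mult_distr.
  split; intros [K1 K2]; split.
  - apply (Rmult_le_compat_l (Cmod l)) in K1; lra.
  - apply (Rmult_le_compat_l (Cmod l ^ 2)) in K2; lra.
  - apply Rmult_le_reg_l with (Cmod l); lra.
  - apply Rmult_le_reg_l with (Cmod l ^ 2); lra.
Qed.

Lemma Psi_le_iff_10 (l a b p : C) : l <> 0%C -> Cmod b < 1 ->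
  Psi_le l a b p <->
  Cmod p <= Cmod l /\ exists b1 b2 : C, Cmod b1 + Cmod b2 <= 1 /\
    a = (b1 * l + Cconj b2 * p)%C /\ (b * l)%C = (b2 * l + Cconj b1 * p)%C.
Proof.
  intros Hl Hb; assert (P : 0 < Cmod l) by now apply Cmod_gt_0.
  destruct (exists_Cmult_eq l a Hl) as [y1 ->], (exists_Cmult_eq l p Hl) as [y3 ->].
  rewrite Psi_le_scal, Psi_contractive_iff_10, Cmod_mult by auto.
  assert (Inj : forall u v, (l * u = l * v)%C -> u = v).
  { intros u v E; transitivity (l * u / l)%C; [|rewrite E]; field; auto. }
  split; intros (K & b1 & b2 & K1 & K2 & K3); split.
  - apply (Rmult_le_compat_l (Cmod l)) in K; lra.
  - exists b1, b2; split; auto; split; [rewrite K2 | rewrite K3 at 1]; ring.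
  - apply Rmult_le_reg_l with (Cmod l); lra.
  - exists b1, b2; split; auto; split; apply Inj.
    + rewrite K2; ring.
    + transitivity (b * l)%C; [ring | rewrite K3; ring].
Qed.

Lemma Hinf_norm_le (f : C -> C) (M : R) :
  Rbar_le (Hinf_norm f) (Finite M) <-> forall z, unit_disc z -> Cmod (f z) <= M.
Proof.
  destruct (Lub_Rbar_correct (fun r : R => exists z, unit_disc z /\ r = Cmod (f z))) as [U V].
  split.
  - intros H z Hz; apply (Rbar_le_trans (Cmod (f z)) (Hinf_norm f) M); auto.
    apply U; now exists z.
  - intros H; apply V; intros r (z & Hz & ->); exact (H z Hz).
Qed.

(** When [p = a b] the numerator is [a (b z - 1)], so the cleared inequality agrees with the
    convention that [Psi] is constant. *)
Lemma Psi_le_iff_5 (l a b p : C) : Cmod b < 1 ->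
  Psi_le l a b p <-> Rbar_le (Hinf_norm (fun z => Psi z (a, b, p))) (Cmod l).
Proof.
  intros Hb; rewrite Hinf_norm_le.
  assert (N : forall z, unit_disc z -> (b * z - 1)%C <> 0%C).
  { intros z Hz E; unfold unit_disc in Hz; apply (one_minus_neq_0 b z); [lra..|].
    replace (1 - b * z)%C with (- (b * z - 1))%C by ring; rewrite E; ring. }
  split; intros H z Hz; specialize (H z Hz); specialize (N z Hz);
    assert (P : 0 < Cmod (b * z - 1)) by (now apply Cmod_gt_0);
    unfold Psi in *; destruct (Ceq_dec (a * b) p) as [<-|D].
  - replace (a * b * z - a)%C with (a * (b * z - 1))%C in H by ring.
    rewrite Cmod_mult in H; now apply Rmult_le_reg_r in H.
  - rewrite Cmod_div by auto; now apply Rle_div_l.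
  - replace (a * b * z - a)%C with (a * (b * z - 1))%C by ring.
    rewrite Cmod_mult; apply Rmult_le_compat_r; lra.
  - rewrite Cmod_div in H by auto; apply Rle_div_l in H; lra.
Qed.

(** * Necessity *)

Lemma ex_derive_comp_linear {U V : NormedModule C_AbsRing} (f : C -> U) (L : U -> V) (z : C) :
  is_linear L -> @ex_derive C_AbsRing U f z -> @ex_derive C_AbsRing V (fun t => L (f t)) z.
Proof.
  intros HL [d Hd]; exists (L d).
  unfold is_derive in *.
  apply (filterdiff_ext_lin _ (fun y : C_AbsRing => L (scal y d))).
  - apply (@filterdiff_comp' C_AbsRing (AbsRing_NormedModule C_AbsRing) U V f L z _ L); auto.
    now apply filterdiff_linear.
  - intros y; apply (linear_scal L HL).
Qed.

Lemma is_linear_pair_zero_r {U V : NormedModule C_AbsRing} :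
  is_linear (fun u : U => (u, zero) : prod_NormedModule C_AbsRing U V).
Proof. apply is_linear_prod; [apply is_linear_id | apply is_linear_zero]. Qed.

Lemma is_linear_pair_zero_l {U V : NormedModule C_AbsRing} :
  is_linear (fun v : V => (zero, v) : prod_NormedModule C_AbsRing U V).
Proof. apply is_linear_prod; [apply is_linear_zero | apply is_linear_id]. Qed.

(** The pair is the sum of its images under the two linear injections into the product. *)
Lemma ex_derive_pair {U V : NormedModule C_AbsRing} (f : C -> U) (g : C -> V) (z : C) :
  @ex_derive C_AbsRing U f z -> @ex_derive C_AbsRing V g z ->
  @ex_derive C_AbsRing (prod_NormedModule C_AbsRing U V) (fun t => (f t, g t)) z.
Proof.
  intros Hf Hg.
  apply (ex_derive_ext (fun t => plus ((f t, zero) : prod_NormedModule C_AbsRing U V)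
                                      ((zero, g t) : prod_NormedModule C_AbsRing U V))).
  - intros t; unfold plus; simpl; unfold prod_plus; simpl.
    now rewrite plus_zero_r, plus_zero_l.
  - apply (@ex_derive_plus C_AbsRing (prod_NormedModule C_AbsRing U V)).
    + apply (ex_derive_comp_linear f _ z is_linear_pair_zero_r Hf).
    + apply (ex_derive_comp_linear g _ z is_linear_pair_zero_l Hg).
Qed.

Lemma ex_derive_triple_iff (phi : C -> C * C * C) (z : C) :
  @ex_derive C_AbsRing (prod_NormedModule C_AbsRing
     (prod_NormedModule C_AbsRing C_NormedModule C_NormedModule) C_NormedModule) phi z <->
  C_differentiable (fun t => fst (fst (phi t))) z /\
  C_differentiable (fun t => snd (fst (phi t))) z /\
  C_differentiable (fun t => snd (phi t)) z.
Proof.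
  split.
  - intros H.
    assert (H1 := ex_derive_comp_linear phi _ z is_linear_fst H).
    assert (H2 := ex_derive_comp_linear phi _ z is_linear_snd H).
    assert (H3 := ex_derive_comp_linear _ _ z is_linear_fst H1).
    assert (H4 := ex_derive_comp_linear _ _ z is_linear_snd H1).
    repeat split; apply C_differentiable_iff; assumption.
  - intros (H1 & H2 & H3).
    apply C_differentiable_iff in H1, H2, H3.
    apply (ex_derive_ext (fun t => (fst (fst (phi t)), snd (fst (phi t)), snd (phi t)))).
    + intros t; now destruct (phi t) as [[u v] w].
    + apply (ex_derive_pair _ _ z (ex_derive_pair _ _ z H1 H2) H3).
Qed.

(* For fixed [z], Schwarz's lemma is applied to [t |-> Psi(z, phi t)]. *)
Lemma Psi_le_of_analytic (f1 f2 f3 : C -> C) :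
  (forall t, unit_disc t -> C_differentiable f1 t /\ C_differentiable f2 t /\ C_differentiable f3 t) ->
  (forall t, unit_disc t -> Psi_contractive (f1 t) (f2 t) (f3 t) /\ Cmod (f2 t) <= 1) ->
  f1 0%C = 0%C -> f2 0%C = 0%C -> f3 0%C = 0%C ->
  forall l, unit_disc l -> Psi_le l (f1 l) (f2 l) (f3 l).
Proof.
  intros Hd Hc E1 E2 E3 l Hl z Hz.
  assert (N : forall t, unit_disc t -> (f2 t * z - 1)%C <> 0%C).
  { intros t Ht E; unfold unit_disc in Hz; destruct (Hc t Ht) as [_ H2].
    apply (one_minus_neq_0 z (f2 t)); [lra..|].
    replace (1 - z * f2 t)%C with (- (f2 t * z - 1))%C by ring; rewrite E; ring. }
  assert (K : Cmod ((f3 l * z - f1 l) / (f2 l * z - 1))%C <= Cmod l).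
  { apply (schwarz_lemma (fun t => (f3 t * z - f1 t) / (f2 t * z - 1))%C); auto.
    - intros t Ht; destruct (Hd t Ht) as (? & ? & ?); auto 6 with cdiff.
    - intros t Ht; specialize (N t Ht); apply Cmod_gt_0 in N as P.
      rewrite Cmod_div by auto.
      apply Rle_div_l; auto; rewrite Rmult_1_l; now apply Hc.
    - rewrite E1, E2, E3; field. }
  specialize (N l Hl); apply Cmod_gt_0 in N as P.
  rewrite Cmod_div in K by auto; apply Rle_div_l in K; auto.
Qed.

(** * Points of the tetrablock and of its closure *)

Lemma tetrablock_swap (x1 x2 x3 : C) : tetrablock (x1, x2, x3) -> tetrablock (x2, x1, x3).
Proof.
  intros H z w Hz Hw E; apply (H w z Hw Hz); rewrite <- E; ring.
Qed.

Lemma tetrablock_Cmod_lt_1 (x1 x2 x3 : C) : tetrablock (x1, x2, x3) -> Cmod x2 < 1.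
Proof.
  intros H; apply Rnot_le_lt; intros L.
  assert (N : x2 <> 0%C) by (apply Cmod_gt_0; lra).
  apply (H 0%C (/ x2)%C).
  - unfold closed_unit_disc; rewrite Cmod_0; lra.
  - unfold closed_unit_disc; rewrite Cmod_inv by auto.
    rewrite <- Rinv_1; apply Rinv_le_contravar; lra.
  - field; auto.
Qed.

(** The defining expression is affine in [z]; solving for [z] puts the root outside the closed disc,
    hence the strict inequality. The bound on [x2] is the case [z = 0]. *)
Lemma tetrablock_iff (x1 x2 x3 : C) : tetrablock (x1, x2, x3) <->
  Cmod x2 < 1 /\
  forall w, closed_unit_disc w -> Cmod (x3 * w - x1)%C < Cmod (x2 * w - 1)%C.
Proof.
  split.
  - intros H; assert (H2 := tetrablock_Cmod_lt_1 _ _ _ H); split; auto.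
    intros w Hw; apply Rnot_le_lt; intros L.
    assert (N : (x2 * w - 1)%C <> 0%C).
    { intros E; unfold closed_unit_disc in Hw; apply (one_minus_neq_0 x2 w); auto.
      replace (1 - x2 * w)%C with (- (x2 * w - 1))%C by ring; rewrite E; ring. }
    assert (P : 0 < Cmod (x2 * w - 1)) by now apply Cmod_gt_0.
    assert (N' : (x3 * w - x1)%C <> 0%C) by (apply Cmod_gt_0; lra).
    apply (H ((x2 * w - 1) / (x3 * w - x1))%C w); auto.
    + unfold closed_unit_disc; rewrite Cmod_div by auto; apply Rle_div_l; lra.
    + field; auto.
  - intros [H2 H] z w Hz Hw E; specialize (H w Hw).
    unfold closed_unit_disc in Hz.
    assert (E' : (x2 * w - 1)%C = (z * (x3 * w - x1))%C).
    { replace (x2 * w - 1)%C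
        with (z * (x3 * w - x1) - (1 - z * x1 - w * x2 + z * w * x3))%C by ring.
      rewrite E; ring. }
    rewrite E', Cmod_mult in H.
    pose proof (Cmod_ge_0 (x3 * w - x1)); nra.
Qed.

Lemma tetrablock_Psi_contractive (x1 x2 x3 : C) :
  tetrablock (x1, x2, x3) -> Psi_contractive x1 x2 x3.
Proof.
  intros H z Hz; left; apply tetrablock_iff in H; apply H.
  unfold closed_unit_disc, unit_disc in *; lra.
Qed.

Lemma locally_C3 (x1 x2 x3 : C) (e : R) : 0 < e ->
  locally (x1, x2, x3) (fun y : C * C * C =>
    Cmod (fst (fst y) - x1)%C < e /\ Cmod (snd (fst y) - x2)%C < e /\ Cmod (snd y - x3)%C < e).
Proof.
  intros He.
  (* A ball of [C] is controlled in modulus only up to the factor [sqrt 2], which the halving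
     absorbs. *)
  assert (Q : 0 < e / 2) by lra.
  exists (mkposreal _ Q); intros [[y1 y2] y3] [[B1 B2] B3]; simpl in B1, B2, B3 |- *.
  assert (S : forall u v : C, ball u (e / 2) v -> Cmod (v - u) < e).
  { intros u v B.
    eapply Rlt_le_trans; [exact (C_NormedModule_mixin_compat2 u v (mkposreal _ Q) B)|].
    simpl; assert (sqrt 2 <= 2).
    { rewrite <- (sqrt_square 2) at 2 by lra; apply sqrt_le_1_alt; lra. }
    nra. }
  auto.
Qed.

Lemma closure_tetrablock_Psi_contractive (x1 x2 x3 : C) :
  closure tetrablock (x1, x2, x3) -> Psi_contractive x1 x2 x3.
Proof.
  intros H z Hz; unfold unit_disc in Hz.
  apply Rnot_lt_le; intros L.
  set (g := Cmod (x3 * z - x1) - Cmod (x2 * z - 1)).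
  (* Each of the three coordinates can shrink the gap by less than [g / 3], so a violation at [x]
     would persist at a nearby point of the tetrablock. *)
  assert (Hg : 0 < g / 3) by (unfold g; lra).
  destruct (H _ (locally_C3 x1 x2 x3 (g / 3) Hg)) as ([[y1 y2] y3] & (H1 & H2 & H3) & Hy).
  simpl in H1, H2, H3.
  assert (K := tetrablock_Psi_contractive _ _ _ Hy z Hz).
  generalize (Cmod_triangle_rev (x3 * z - x1) ((x3 - y3) * z - (x1 - y1))).
  replace (x3 * z - x1 - ((x3 - y3) * z - (x1 - y1)))%C with (y3 * z - y1)%C by ring.
  generalize (Cmod_triangle_minus ((x3 - y3) * z) (x1 - y1)).
  generalize (Cmod_triangle (x2 * z - 1) ((y2 - x2) * z)).
  replace (x2 * z - 1 + (y2 - x2) * z)%C with (y2 * z - 1)%C by ring.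
  rewrite !Cmod_mult, (Cmod_minus_sym x3), (Cmod_minus_sym x1).
  pose proof (Cmod_ge_0 z); pose proof (Cmod_ge_0 (y3 - x3)); pose proof (Cmod_ge_0 (y2 - x2)).
  assert (Cmod (y3 - x3) * Cmod z <= Cmod (y3 - x3)) by nra.
  assert (Cmod (y2 - x2) * Cmod z <= Cmod (y2 - x2)) by nra.
  unfold g in *; lra.
Qed.

Lemma closure_tetrablock_swap (x1 x2 x3 : C) :
  closure tetrablock (x1, x2, x3) -> closure tetrablock (x2, x1, x3).
Proof.
  intros H V [e He].
  destruct (H (fun y => V (snd (fst y), fst (fst y), snd y))) as ([[y1 y2] y3] & Hy & T).
  - exists e; intros [[y1 y2] y3] [[B1 B2] B3]; apply He; exact (conj (conj B2 B1) B3).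
  - exists (y2, y1, y3); split; auto; now apply tetrablock_swap.
Qed.

Lemma Psi_contractive_Cmod_le_1 (x1 x2 x3 : C) : Psi_contractive x1 x2 x3 -> Cmod x1 <= 1.
Proof.
  intros H; specialize (H 0%C); rewrite Cmod_minus_sym in H.
  replace (x1 - x3 * 0)%C with x1 in H by ring.
  replace (x2 * 0 - 1)%C with (- (1))%C in H by ring.
  rewrite Cmod_opp, Cmod_1 in H; apply H; unfold unit_disc; rewrite Cmod_0; lra.
Qed.

Lemma Psi_le_of_closure_valued (phi : C -> C * C * C) (l a b p : C) : unit_disc l ->
  analytic_on_disc phi -> (forall z, unit_disc z -> closure tetrablock (phi z)) ->
  phi 0%C = (RtoC 0, RtoC 0, RtoC 0) -> phi l = (a, b, p) ->
  Psi_le l a b p /\ Psi_le l b a p.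
Proof.
  intros Hl Hd Hc H0 Hphi.
  assert (Hd' := fun z Hz => proj1 (ex_derive_triple_iff phi z) (Hd z Hz)).
  assert (Hc1 : forall z, unit_disc z ->
    Psi_contractive (fst (fst (phi z))) (snd (fst (phi z))) (snd (phi z)) /\
    Psi_contractive (snd (fst (phi z))) (fst (fst (phi z))) (snd (phi z))).
  { intros z Hz; specialize (Hc z Hz); destruct (phi z) as [[x1 x2] x3]; split;
      apply closure_tetrablock_Psi_contractive; auto; now apply closure_tetrablock_swap. }
  assert (B := fun z Hz => Psi_contractive_Cmod_le_1 _ _ _ (proj1 (Hc1 z Hz))).
  assert (B' := fun z Hz => Psi_contractive_Cmod_le_1 _ _ _ (proj2 (Hc1 z Hz))).
  split.
  - generalize (Psi_le_of_analytic (fun z => fst (fst (phi z))) (fun z => snd (fst (phi z)))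
      (fun z => snd (phi z))); cbv beta; rewrite H0; intros K.
    specialize (K Hd' (fun z Hz => conj (proj1 (Hc1 z Hz)) (B' z Hz)) eq_refl eq_refl eq_refl l Hl).
    now rewrite Hphi in K.
  - generalize (Psi_le_of_analytic (fun z => snd (fst (phi z))) (fun z => fst (fst (phi z)))
      (fun z => snd (phi z))); cbv beta; rewrite H0; intros K.
    assert (Hd2 : forall z, unit_disc z -> C_differentiable (fun t => snd (fst (phi t))) z /\
      C_differentiable (fun t => fst (fst (phi t))) z /\ C_differentiable (fun t => snd (phi t)) z)
      by (intros z Hz; destruct (Hd' z Hz) as (? & ? & ?); auto).
    specialize (K Hd2 (fun z Hz => conj (proj2 (Hc1 z Hz)) (B z Hz)) eq_refl eq_refl eq_refl l Hl).
    now rewrite Hphi in K.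
Qed.

(** * Contractive matrices and the Schur class *)

Definition mat2 (a b c d : C) : @matrix C 2 2 :=
  mk_matrix 2 2 (fun i j => match i, j with
    | O, O => a | O, _ => b | _, O => c | _, _ => d end).

Definition contraction2 (a b c d : C) : Prop := forall u v : C,
  Cmod (a * u + b * v)%C ^ 2 + Cmod (c * u + d * v)%C ^ 2 <= Cmod u ^ 2 + Cmod v ^ 2.

Lemma entry_Mmult (A : @matrix C 2 2) (v : @matrix C 2 1) (i : nat) : (i < 2)%nat ->
  entry (@Mmult C_Ring 2 2 1 A v) i 0
    = (entry A i 0 * entry v 0 0 + entry A i 1 * entry v 1 0)%C.
Proof.
  intros Hi; unfold entry at 1, Mmult; rewrite coeff_mat_bij by (auto; lia).
  simpl pred; rewrite sum_Sn, sum_O; reflexivity.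
Qed.

Lemma vec_norm_le_1 (v : @matrix C 2 1) :
  vec_norm v <= 1 <-> Cmod (entry v 0 0) ^ 2 + Cmod (entry v 1 0) ^ 2 <= 1.
Proof.
  unfold vec_norm.
  pose proof (pow2_ge_0 (Cmod (entry v 0 0))); pose proof (pow2_ge_0 (Cmod (entry v 1 0))).
  split; intros K.
  - rewrite <- (sqrt_sqrt (_ + _)) by lra.
    assert (0 <= sqrt (Cmod (entry v 0 0) ^ 2 + Cmod (entry v 1 0) ^ 2)) by apply sqrt_pos.
    nra.
  - rewrite <- sqrt_1; now apply sqrt_le_1_alt.
Qed.

Lemma op_norm_le_1_iff (A : @matrix C 2 2) :
  Rbar_le (op_norm A) 1 <->
  contraction2 (entry A 0 0) (entry A 0 1) (entry A 1 0) (entry A 1 1).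
Proof.
  destruct (Lub_Rbar_correct (fun r : R => exists v : @matrix C 2 1,
    vec_norm v <= 1 /\ r = vec_norm (@Mmult C_Ring 2 2 1 A v))) as [U V].
  split.
  - intros H u v.
    set (N := Cmod u ^ 2 + Cmod v ^ 2).
    pose proof (pow2_ge_0 (Cmod u)); pose proof (pow2_ge_0 (Cmod v)).
    destruct (Rle_lt_dec N 0) as [Z|HN].
    { assert (Eu : u = 0%C) by (apply Cmod_eq_0; unfold N in Z; nra).
      assert (Ev : v = 0%C) by (apply Cmod_eq_0; unfold N in Z; nra).
      unfold N; rewrite Eu, Ev.
      replace (entry A 0 0 * 0 + entry A 0 1 * 0)%C with (RtoC 0) by ring.
      replace (entry A 1 0 * 0 + entry A 1 1 * 0)%C with (RtoC 0) by ring.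
      lra. }
    set (t := / sqrt N).
    assert (Hs : 0 < sqrt N) by now apply sqrt_lt_R0.
    assert (Ht : 0 < t) by now apply Rinv_0_lt_compat.
    assert (Et : t ^ 2 * N = 1).
    { rewrite <- (sqrt_sqrt N) by lra; unfold t; field; lra. }
    set (w := mk_matrix 2 1 (fun i _ => match i with O => RtoC t * u | _ => RtoC t * v end)%C).
    assert (Hw : vec_norm w <= 1).
    { apply vec_norm_le_1; change (Cmod (t * u) ^ 2 + Cmod (t * v) ^ 2 <= 1).
      rewrite !Cmod_mult, Cmod_R, (Rabs_pos_eq t), !Rpow_mult_distr by lra.
      unfold N in Et; lra. }
    assert (K : vec_norm (@Mmult C_Ring 2 2 1 A w) <= 1).
    { apply (Rbar_le_trans (Finite (vec_norm (@Mmult C_Ring 2 2 1 A w))) (op_norm A) (Finite 1)); auto.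
      apply U; now exists w. }
    apply vec_norm_le_1 in K; rewrite !entry_Mmult in K by lia.
    change (entry w 0 0) with (RtoC t * u)%C in K.
    change (entry w 1 0) with (RtoC t * v)%C in K.
    replace (entry A 0 0 * (t * u) + entry A 0 1 * (t * v))%C
      with (t * (entry A 0 0 * u + entry A 0 1 * v))%C in K by ring.
    replace (entry A 1 0 * (t * u) + entry A 1 1 * (t * v))%C
      with (t * (entry A 1 0 * u + entry A 1 1 * v))%C in K by ring.
    rewrite !(Cmod_mult (RtoC t)), Cmod_R, (Rabs_pos_eq t), !Rpow_mult_distr in K by lra.
    apply Rmult_le_reg_l with (t ^ 2); [now apply pow_lt | lra].
  - intros H; apply V; intros r (v & Hv1 & ->); simpl.
    apply vec_norm_le_1; rewrite !entry_Mmult by lia.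
    apply vec_norm_le_1 in Hv1; eapply Rle_trans; [apply H | exact Hv1].
Qed.

(* Apply the contraction to [(1 - d z, c z)], which it maps to [(a - (a d - b c) z, c)]. *)
Lemma contraction2_Psi_contractive (a b c d : C) : contraction2 a b c d ->
  Psi_contractive a d (a * d - b * c)%C.
Proof.
  intros H z Hz; unfold unit_disc in Hz.
  specialize (H (1 - d * z)%C (c * z)%C).
  replace (a * (1 - d * z) + b * (c * z))%C with (a - (a * d - b * c) * z)%C in H by ring.
  replace (c * (1 - d * z) + d * (c * z))%C with c in H by ring.
  rewrite (Cmod_mult c) in H.
  rewrite Cmod_minus_sym, (Cmod_minus_sym (d * z)).
  apply Rsqr_incr_0_var; [|apply Cmod_ge_0]; unfold Rsqr.
  pose proof (Cmod_ge_0 z); pose proof (pow2_ge_0 (Cmod c)).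
  assert (0 <= Cmod c ^ 2 * (1 - Cmod z ^ 2)) by (apply Rmult_le_pos; nra).
  nra.
Qed.

Lemma contraction2_swap (a b c d : C) : contraction2 a b c d -> contraction2 d c b a.
Proof.
  intros H u v; specialize (H v u).
  replace (d * u + c * v)%C with (c * v + d * u)%C by ring.
  replace (b * u + a * v)%C with (a * v + b * u)%C by ring; lra.
Qed.

Lemma Psi_le_of_schur (F : C -> @matrix C 2 2) (l : C) : unit_disc l -> schur_class F ->
  entry (F 0%C) 0 0 = 0%C -> entry (F 0%C) 1 0 = 0%C -> entry (F 0%C) 1 1 = 0%C ->
  Psi_le l (entry (F l) 0 0) (entry (F l) 1 1) (det2 (F l)) /\
  Psi_le l (entry (F l) 1 1) (entry (F l) 0 0) (det2 (F l)).
Proof.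
  intros Hl [Hd Hn] E00 E10 E11.
  assert (D : forall i j z, (i < 2)%nat -> (j < 2)%nat -> unit_disc z ->
    C_differentiable (fun t => entry (F t) i j) z).
  { intros i j z Hi Hj Hz; apply C_differentiable_iff; exact (Hd i j Hi Hj z Hz). }
  assert (Ddet : forall z, unit_disc z -> C_differentiable (fun t => det2 (F t)) z).
  { intros z Hz; unfold det2; auto 8 with cdiff. }
  assert (E0 : det2 (F 0%C) = 0%C) by (unfold det2; rewrite E00, E10, E11; ring).
  assert (K : forall z, unit_disc z ->
    Psi_contractive (entry (F z) 0 0) (entry (F z) 1 1) (det2 (F z)) /\
    Psi_contractive (entry (F z) 1 1) (entry (F z) 0 0) (det2 (F z))).
  { intros z Hz; specialize (Hn z Hz); apply op_norm_le_1_iff in Hn; split.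
    - now apply contraction2_Psi_contractive.
    - apply contraction2_swap, contraction2_Psi_contractive in Hn.
      replace (det2 (F z)) with
        (entry (F z) 1 1 * entry (F z) 0 0 - entry (F z) 1 0 * entry (F z) 0 1)%C; auto.
      unfold det2; ring. }
  split.
  - apply (Psi_le_of_analytic (fun z => entry (F z) 0 0) (fun z => entry (F z) 1 1)
      (fun z => det2 (F z))); auto 7.
    intros z Hz; split; [now apply K|].
    eapply Psi_contractive_Cmod_le_1; now apply K.
  - apply (Psi_le_of_analytic (fun z => entry (F z) 1 1) (fun z => entry (F z) 0 0)
      (fun z => det2 (F z))); auto 7.
    intros z Hz; split; [now apply K|].
    eapply Psi_contractive_Cmod_le_1; now apply K.
Qed.

(** * Construction of the interpolating functions *)

(* In the representation [x1 = b1 + b2^* x3], [x2 = b2 + b1^* x3] the constants [b1, b2] are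
   kept and [x3] is replaced by a Moebius map [psi] with [psi l = y3] chosen so that the second
   coordinate vanishes at [0]; this needs exactly [|b| <= |l y1|]. *)
Lemma exists_interpolant (l y1 b y3 : C) : l <> 0%C -> unit_disc l -> Cmod b < 1 ->
  Cmod b <= Cmod (l * y1)%C -> Psi_contractive y1 b y3 ->
  exists (b1 b2 : C) (psi : C -> C),
    Cmod b1 + Cmod b2 <= 1 /\
    (forall z, unit_disc z -> C_differentiable psi z /\ Cmod (psi z) <= 1) /\
    (b2 + Cconj b1 * psi 0)%C = 0%C /\
    y1 = (b1 + Cconj b2 * psi l)%C /\ b = (b2 + Cconj b1 * psi l)%C /\ y3 = psi l.
Proof.
  intros Hl Hl1 Hb Hby H.
  apply Psi_contractive_iff_10 in H; auto.
  destruct H as (H3 & b1 & b2 & Hb12 & E1 & E2).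
  unfold unit_disc in Hl1; rewrite Cmod_mult in Hby.
  pose proof (Cmod_ge_0 l) as Pl; pose proof (Cmod_ge_0 y1) as P1.
  pose proof (Cmod_ge_0 y3) as P3; pose proof (Cmod_ge_0 b) as Pb.
  assert (Pl' : 0 < Cmod l) by now apply Cmod_gt_0.
  (* Here [k] below would divide by zero; but then [b = 0] too, and a constant [psi] with
     [b1 = b2 = 0] works. *)
  destruct (Ceq_dec y1 0%C) as [Ey|Ny].
  { assert (Eb : b = 0%C) by (apply Cmod_eq_0; rewrite Ey, Cmod_0 in Hby; lra).
    exists 0%C, 0%C, (fun _ => y3); rewrite Cmod_0.
    assert (E0 : Cconj 0 = 0%C) by apply Cconj_RtoC.
    rewrite !E0, Ey, Eb; repeat split; try ring; auto with cdiff; lra. }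
  assert (Py : 0 < Cmod y1) by now apply Cmod_gt_0.
  assert (Hlt : Cmod b < Cmod y1) by nra.
  (* Since [|b| <= |l y1| < |y1|], the left side is positive, which forces [|b2| < |b1|]. *)
  assert (Id : Cmod y1 ^ 2 - Cmod b ^ 2 = (Cmod b1 ^ 2 - Cmod b2 ^ 2) * (1 - Cmod y3 ^ 2)).
  { rewrite E1, E2, !Cmod2_Re_Im; unfold Re, Im; simpl; ring. }
  pose proof (Cmod_ge_0 b1) as Q1; pose proof (Cmod_ge_0 b2) as Q2.
  assert (H21 : Cmod b2 < Cmod b1).
  { apply Rnot_le_lt; intros L.
    assert (Cmod b1 ^ 2 <= Cmod b2 ^ 2) by (apply pow_incr; lra).
    assert (0 <= (Cmod b2 ^ 2 - Cmod b1 ^ 2) * (1 - Cmod y3 ^ 2)) by (apply Rmult_le_pos; nra).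
    nra. }
  assert (Nb1 : b1 <> 0%C) by (apply Cmod_gt_0; lra).
  assert (Nb1' : Cconj b1 <> 0%C) by (apply Cmod_gt_0; rewrite Cmod_conj; lra).
  (* The root of [b2 + conj b1 s], hence the value required of [psi] at [0]; [|b2| < |b1|] places it
     in the disc. *)
  set (w0 := (- b2 / Cconj b1)%C).
  (* Solves [k l = (y3 - w0) / (1 - conj w0 y3)], that is [psi l = y3], because
     [y3 - w0 = b / conj b1] and [1 - conj w0 y3 = y1 / b1]. Its modulus is [|b| / |l y1|], at most
     one by hypothesis. *)
  set (k := (b * b1 / (l * y1 * Cconj b1))%C).
  assert (Hw0 : Cmod w0 < 1).
  { unfold w0; rewrite Cmod_div, Cmod_opp, Cmod_conj by auto; apply Rlt_div_l; lra. }
  assert (Hk : Cmod k <= 1).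
  { unfold k; rewrite Cmod_div, !Cmod_mult, Cmod_conj by (repeat apply Cmult_neq_0; auto).
    assert (0 < Cmod l * Cmod y1) by now apply Rmult_lt_0_compat.
    apply Rle_div_l; [apply Rmult_lt_0_compat; lra | nra]. }
  assert (Hkz : forall z, unit_disc z -> Cmod (k * z)%C < 1).
  { intros z Hz; unfold unit_disc in Hz; rewrite Cmod_mult.
    pose proof (Cmod_ge_0 z); pose proof (Cmod_ge_0 k); nra. }
  assert (Nd : forall z, unit_disc z -> (1 + Cconj w0 * (k * z))%C <> 0%C).
  { intros z Hz; replace (1 + Cconj w0 * (k * z))%C with (1 - - Cconj w0 * (k * z))%C by ring.
    apply one_minus_neq_0; [now rewrite Cmod_opp, Cmod_conj | left; auto]. }
  set (psi := fun z => ((k * z + w0) / (1 + Cconj w0 * (k * z)))%C).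
  assert (Ew0 : Cconj w0 = (- Cconj b2 / b1)%C)
    by (unfold w0; rewrite Cdiv_conj, Copp_conj, Cconj_conj by auto; reflexivity).
  assert (Hpl : psi l = y3).
  { assert (N1 : (1 - w0 * Cconj w0)%C <> 0%C).
    { apply one_minus_neq_0; rewrite ?Cmod_conj; lra. }
    assert (N2 : (1 - Cconj w0 * y3)%C <> 0%C)
      by (apply one_minus_neq_0; [now rewrite Cmod_conj | lra]).
    assert (E : (k * l)%C = ((y3 - w0) / (1 - Cconj w0 * y3))%C).
    { replace (y3 - w0)%C with (b / Cconj b1)%C
        by (unfold w0; rewrite E2; field; auto).
      replace (1 - Cconj w0 * y3)%C with (y1 / b1)%C
        by (rewrite Ew0, E1; field; auto).
      unfold k; field; auto. }
    unfold psi; rewrite E.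
    field.
    split; [exact N2|].
    intros Z; apply N1; rewrite <- Z; ring. }
  exists b1, b2, psi; rewrite Hpl; repeat split; auto.
  - apply C_differentiable_div; auto 6 with cdiff.
  - specialize (Nd z H); unfold psi; apply Cmod_gt_0 in Nd as P.
    rewrite Cmod_div by auto; apply Rle_div_l; auto; rewrite Rmult_1_l.
    apply Rsqr_incr_0_var; [|lra]; unfold Rsqr.
    generalize (moebius_Cmod_identity w0 (k * z)); specialize (Hkz z H).
    pose proof (Cmod_ge_0 w0); pose proof (Cmod_ge_0 (k * z)).
    assert (0 <= (1 - Cmod w0 ^ 2) * (1 - Cmod (k * z) ^ 2)) by (apply Rmult_le_pos; nra).
    lra.
  - unfold psi; replace (k * 0)%C with (RtoC 0) by ring.
    unfold w0 at 1; field; auto.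
Qed.

Lemma Psi_contractive_closed (x1 x2 x3 w : C) : Psi_contractive x1 x2 x3 ->
  closed_unit_disc w -> Cmod (x3 * w - x1)%C <= Cmod (x2 * w - 1)%C.
Proof.
  intros H [L|E]; [now apply H | now apply Psi_contractive_circle].
Qed.

(** The factor [|t| < 1] makes the weak inequality on the closed disc strict; where the left side
    vanishes, [|x2| < 1] keeps the right side positive. *)
Lemma tetrablock_scal (t x1 x2 x3 : C) : unit_disc t -> Cmod x2 < 1 ->
  Psi_contractive x1 x2 x3 -> tetrablock ((t * x1)%C, x2, (t * x3)%C).
Proof.
  intros Ht H2 H; apply tetrablock_iff; split; auto; intros w Hw.
  assert (K := Psi_contractive_closed _ _ _ w H Hw).
  replace (t * x3 * w - t * x1)%C with (t * (x3 * w - x1))%C by ring.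
  rewrite Cmod_mult; unfold unit_disc in Ht; unfold closed_unit_disc in Hw.
  assert (P : 0 < Cmod (x2 * w - 1)).
  { apply Cmod_gt_0; intros E; apply (one_minus_neq_0 x2 w); auto.
    replace (1 - x2 * w)%C with (- (x2 * w - 1))%C by ring; rewrite E; ring. }
  pose proof (Cmod_ge_0 t); pose proof (Cmod_ge_0 (x3 * w - x1)); nra.
Qed.

Lemma Cmod_conj_comb_le_1 (b1 b2 s : C) : Cmod b1 + Cmod b2 <= 1 -> Cmod s <= 1 ->
  Cmod (b2 + Cconj b1 * s)%C <= 1.
Proof.
  intros Hb Hs; eapply Rle_trans; [apply Cmod_triangle|].
  rewrite Cmod_mult, Cmod_conj; pose proof (Cmod_ge_0 b1); nra.
Qed.

Lemma exists_tetrablock_map (l a b p : C) : l <> 0%C -> unit_disc l -> Cmod b < 1 ->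
  Cmod b <= Cmod a -> Psi_le l a b p ->
  exists phi1 phi2 phi3 : C -> C,
    (forall z, unit_disc z -> C_differentiable phi1 z /\ C_differentiable phi2 z /\
       C_differentiable phi3 z /\ tetrablock (phi1 z, phi2 z, phi3 z)) /\
    phi1 0%C = 0%C /\ phi2 0%C = 0%C /\ phi3 0%C = 0%C /\
    phi1 l = a /\ phi2 l = b /\ phi3 l = p.
Proof.
  intros Hl Hl1 Hb Hab H.
  destruct (exists_Cmult_eq l a Hl) as [y1 ->], (exists_Cmult_eq l p Hl) as [y3 ->].
  apply Psi_le_scal in H; auto.
  destruct (exists_interpolant l y1 b y3) as (b1 & b2 & psi & Hb12 & Hpsi & E0 & E1 & E2 & E3);
    auto.
  assert (Hbd : forall z, unit_disc z -> Cmod (b2 + Cconj b1 * psi z)%C <= 1).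
  { intros z Hz; destruct (Hpsi z Hz); now apply Cmod_conj_comb_le_1. }
  assert (Hd : forall z, unit_disc z -> C_differentiable (fun z => b2 + Cconj b1 * psi z)%C z).
  { intros z Hz; destruct (Hpsi z Hz); auto with cdiff. }
  exists (fun z => z * (b1 + Cconj b2 * psi z))%C, (fun z => b2 + Cconj b1 * psi z)%C,
    (fun z => z * psi z)%C.
  split.
  - intros z Hz; destruct (Hpsi z Hz) as [D B].
    repeat split; auto 6 with cdiff.
    (* The second coordinate carries no factor [z]; since it vanishes at [0], Schwarz's lemma
       supplies the strict bound needed for the open tetrablock. *)
    assert (L := schwarz_lemma _ Hd Hbd E0 z Hz); cbv beta in L.
    unfold unit_disc in Hz.
    apply tetrablock_scal; auto; [lra|].
    apply Psi_contractive_iff_10; [lra|].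
    split; auto; now exists b1, b2.
  - rewrite E3, E1; repeat split; auto; ring.
Qed.

(** The requirements amount to [(m + n)^2 = 1 - (s - t)^2] and [(m - n)^2 = 1 - (s + t)^2]; [A] and
    [B] are the roots. *)
Lemma exists_sqrt_pair (s t : R) : 0 <= s -> 0 <= t -> s + t <= 1 ->
  exists m n : R, 0 <= m /\ 0 <= n /\ m * n = s * t /\ m ^ 2 + n ^ 2 = 1 - s ^ 2 - t ^ 2.
Proof.
  intros Hs Ht H.
  assert (A1 : 0 <= 1 - (s - t) ^ 2) by nra.
  assert (A2 : 0 <= 1 - (s + t) ^ 2) by nra.
  set (A := sqrt (1 - (s - t) ^ 2)); set (B := sqrt (1 - (s + t) ^ 2)).
  assert (EA : A * A = 1 - (s - t) ^ 2) by now apply sqrt_sqrt.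
  assert (EB : B * B = 1 - (s + t) ^ 2) by now apply sqrt_sqrt.
  assert (PA : 0 <= A) by apply sqrt_pos.
  assert (PB : 0 <= B) by apply sqrt_pos.
  assert (AB : B <= A) by (apply sqrt_le_1_alt; nra).
  exists ((A + B) / 2), ((A - B) / 2); repeat split; try lra.
Qed.

(* Writing the matrix as [M0 + s M1], the choice of [m, n] makes [M0] of rank one and Hilbert-
   Schmidt norm one, whence [M0^* M0 + M1^* M1 = 1] and [M0^* M1 = 0]: the matrix is
   [U diag(1, s) V] with [U], [V] unitary. *)
Lemma exists_contraction_family (b1 b2 : C) : Cmod b1 + Cmod b2 <= 1 ->
  exists m n : C, forall s : C,
    (Cmod s <= 1 ->
     contraction2 (b1 + Cconj b2 * s) (m - Cconj n * s) (n - Cconj m * s) (b2 + Cconj b1 * s)) /\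
    ((b1 + Cconj b2 * s) * (b2 + Cconj b1 * s) - (m - Cconj n * s) * (n - Cconj m * s))%C = s.
Proof.
  intros H.
  destruct (exists_sqrt_pair (Cmod b1) (Cmod b2)) as (m & n & Hm & Hn & Emn & Esq);
    auto using Cmod_ge_0.
  destruct (exists_aligned (b1 * b2)) as (t & Ht & Et).
  (* The real pair only matches the modulus of [b1 b2]; its phase [conj t] is put entirely on the
     first number, so that the product is [b1 b2] itself. *)
  exists (Cconj t * RtoC m)%C, (RtoC n).
  set (M := (Cconj t * RtoC m)%C); set (N := RtoC n).
  assert (Tt : (Cconj t * t)%C = 1%C) by (rewrite Cconj_mult_self, Ht; f_equal; ring).
  assert (E1 : (M * N)%C = (b1 * b2)%C).
  { transitivity (Cconj t * RtoC (m * n))%C; [unfold M, N; rewrite RtoC_mult; ring|].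
    rewrite Emn, <- Cmod_mult, <- Et, Cmult_assoc, Tt; ring. }
  assert (E2 : (Cconj M * Cconj N)%C = (Cconj b1 * Cconj b2)%C)
    by (rewrite <- !Cmult_conj, E1; reflexivity).
  assert (EM : Cmod M = m).
  { unfold M; rewrite Cmod_mult, Cmod_conj, Ht, Cmod_R, Rabs_pos_eq by auto; ring. }
  assert (EN : Cmod N = n) by (unfold N; rewrite Cmod_R; now apply Rabs_pos_eq).
  assert (E3 : (Cconj b1 * b1 + Cconj b2 * b2 + Cconj M * M + Cconj N * N)%C = 1%C).
  { rewrite !Cconj_mult_self, EM, EN, <- !RtoC_plus; f_equal; lra. }
  clearbody M N; clear t Ht Et Tt Emn Esq Hm Hn EM EN H m n.
  intros s; split.
  - intros Hs u v.
    set (p0 := (b1 * u + M * v)%C); set (p1 := (N * u + b2 * v)%C).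
    set (q0 := (Cconj b2 * u - Cconj N * v)%C); set (q1 := (Cconj b1 * v - Cconj M * u)%C).
    replace ((b1 + Cconj b2 * s) * u + (M - Cconj N * s) * v)%C
      with (p0 + s * q0)%C by (unfold p0, q0; ring).
    replace ((N - Cconj M * s) * u + (b2 + Cconj b1 * s) * v)%C
      with (p1 + s * q1)%C by (unfold p1, q1; ring).
    (* The images of [(u, v)] under [M0] and [M1] are orthogonal, so the norm of their combination
       is given by Pythagoras in [P]. *)
    assert (O : (p0 * Cconj q0 + p1 * Cconj q1)%C = 0%C).
    { unfold p0, p1, q0, q1; rewrite !Cminus_conj, !Cmult_conj, !Cconj_conj.
      transitivity ((b1 * b2 - M * N) * (Cconj u * u + Cconj v * v))%C; [ring|].
      rewrite E1; ring. }
    assert (S : Cmod p0 ^ 2 + Cmod p1 ^ 2 + (Cmod q0 ^ 2 + Cmod q1 ^ 2)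
                = Cmod u ^ 2 + Cmod v ^ 2).
    { apply RtoC_inj; rewrite !RtoC_plus, <- !Cconj_mult_self.
      unfold p0, p1, q0, q1; rewrite !Cminus_conj, !Cplus_conj, !Cmult_conj, !Cconj_conj.
      transitivity ((Cconj b1 * b1 + Cconj b2 * b2 + Cconj M * M + Cconj N * N)
                    * (Cconj u * u + Cconj v * v))%C; [ring|].
      rewrite E3; ring. }
    assert (P : Cmod (p0 + s * q0)%C ^ 2 + Cmod (p1 + s * q1)%C ^ 2
      = Cmod p0 ^ 2 + Cmod p1 ^ 2 + Cmod s ^ 2 * (Cmod q0 ^ 2 + Cmod q1 ^ 2)).
    { apply RtoC_inj; rewrite !RtoC_plus, RtoC_mult, !RtoC_plus, <- !Cconj_mult_self.
      rewrite !Cplus_conj, !Cmult_conj.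
      assert (O' : (Cconj p0 * q0 + Cconj p1 * q1)%C = 0%C).
      { transitivity (Cconj (p0 * Cconj q0 + p1 * Cconj q1)).
        - now rewrite Cplus_conj, !Cmult_conj, !Cconj_conj.
        - rewrite O; apply Cconj_RtoC. }
      transitivity (Cconj p0 * p0 + Cconj p1 * p1
        + Cconj s * s * (Cconj q0 * q0 + Cconj q1 * q1)
        + s * (Cconj p0 * q0 + Cconj p1 * q1) + Cconj s * (p0 * Cconj q0 + p1 * Cconj q1))%C;
        [ring|].
      rewrite O, O'; ring. }
    rewrite P, <- S.
    pose proof (Cmod_ge_0 s); pose proof (pow2_ge_0 (Cmod q0)); pose proof (pow2_ge_0 (Cmod q1)).
    assert (Cmod s ^ 2 <= 1) by nra.
    nra.
  (* As a polynomial in [s] the determinant has vanishing constant and quadratic coefficients by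
     [E1] and [E2], and linear coefficient one by [E3]. *)
  - transitivity (b1 * b2 - M * N
      + s * (Cconj b1 * b1 + Cconj b2 * b2 + Cconj M * M + Cconj N * N)
      + s * s * (Cconj b1 * Cconj b2 - Cconj M * Cconj N))%C; [ring|].
    rewrite E1, E2, E3; ring.
Qed.

Lemma contraction2_scal_col (t a b c d : C) : Cmod t <= 1 -> contraction2 a b c d ->
  contraction2 (t * a) b (t * c) d.
Proof.
  intros Ht H u v; specialize (H (t * u)%C v).
  replace (t * a * u + b * v)%C with (a * (t * u) + b * v)%C by ring.
  replace (t * c * u + d * v)%C with (c * (t * u) + d * v)%C by ring.
  eapply Rle_trans; [exact H|].
  rewrite Cmod_mult, Rpow_mult_distr.
  pose proof (Cmod_ge_0 t); pose proof (pow2_ge_0 (Cmod u)).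
  assert (Cmod t ^ 2 <= 1) by nra; nra.
Qed.

Lemma contraction2_scal_row (t a b c d : C) : Cmod t <= 1 -> contraction2 a b c d ->
  contraction2 a b (t * c) (t * d).
Proof.
  intros Ht H u v; specialize (H u v).
  replace (t * c * u + t * d * v)%C with (t * (c * u + d * v))%C by ring.
  rewrite (Cmod_mult t), Rpow_mult_distr.
  pose proof (Cmod_ge_0 t); pose proof (pow2_ge_0 (Cmod (c * u + d * v))).
  assert (Cmod t ^ 2 <= 1) by nra; nra.
Qed.

Lemma schur_class_mat2 (f g h k : C -> C) :
  (forall z, unit_disc z -> C_differentiable f z /\ C_differentiable g z /\
     C_differentiable h z /\ C_differentiable k z /\ contraction2 (f z) (g z) (h z) (k z)) ->
  schur_class (fun z => mat2 (f z) (g z) (h z) (k z)).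
Proof.
  intros H; split.
  - intros i j Hi Hj z Hz; destruct (H z Hz) as (Hf & Hg & Hh & Hk & _).
    destruct i as [|[|i]]; [| |lia]; (destruct j as [|[|j]]; [| |lia]);
      apply C_differentiable_iff; assumption.
  - intros z Hz; apply op_norm_le_1_iff; now apply H.
Qed.

Definition schur_interpolates (l a b p : C) : Prop := exists F : C -> @matrix C 2 2,
  schur_class F /\
  entry (F 0%C) 0 0 = 0%C /\ entry (F 0%C) 1 0 = 0%C /\ entry (F 0%C) 1 1 = 0%C /\
  (a, b, p) = (entry (F l) 0 0, entry (F l) 1 1, det2 (F l)).

(* [F = G diag(z, 1)] for the first order of the first two coordinates and
   [F = diag(1, z) G] for the second, with [G] from [exists_contraction_family] at [psi z]. *)
Lemma exists_schur (l a b p : C) : l <> 0%C -> unit_disc l -> Cmod b < 1 ->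
  Cmod b <= Cmod a -> Psi_le l a b p ->
  schur_interpolates l a b p /\ schur_interpolates l b a p.
Proof.
  intros Hl Hl1 Hb Hab H.
  destruct (exists_Cmult_eq l a Hl) as [y1 ->], (exists_Cmult_eq l p Hl) as [y3 ->].
  apply Psi_le_scal in H; auto.
  destruct (exists_interpolant l y1 b y3) as (b1 & b2 & psi & Hb12 & Hpsi & E0 & E1 & E2 & E3);
    auto.
  split.
  - destruct (exists_contraction_family b1 b2 Hb12) as (m & n & Hmn).
    exists (fun z => mat2 (z * (b1 + Cconj b2 * psi z)) (m - Cconj n * psi z)
      (z * (n - Cconj m * psi z)) (b2 + Cconj b1 * psi z))%C.
    split; [apply schur_class_mat2|unfold det2; simpl]; [|repeat split].
    + intros z Hz; destruct (Hpsi z Hz) as [D B].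
      repeat split; auto 6 with cdiff.
      apply contraction2_scal_col; [left; exact Hz | now apply Hmn].
    + change (0 * (b1 + Cconj b2 * psi 0) = 0)%C; ring.
    + change (0 * (n - Cconj m * psi 0) = 0)%C; ring.
    + exact E0.
    + destruct (Hmn (psi l)) as [_ Dt].
      cbv [entry mat2 coeff_mat mk_matrix mk_Tn Tn fst snd]; simpl.
      f_equal; [f_equal; [now rewrite E1 | exact E2]|].
      apply (f_equal (Cmult l)) in Dt; rewrite E3, <- Dt; ring.
  (* Exchanging [b1] and [b2] exchanges the diagonal entries of the family. The factor [z] moves to
     the second row, because the lower left entry still has to vanish at [0]. *)
  - rewrite Rplus_comm in Hb12.
    destruct (exists_contraction_family b2 b1 Hb12) as (m & n & Hmn).
    exists (fun z => mat2 (b2 + Cconj b1 * psi z) (m - Cconj n * psi z)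
      (z * (n - Cconj m * psi z)) (z * (b1 + Cconj b2 * psi z)))%C.
    split; [apply schur_class_mat2|unfold det2; simpl]; [|repeat split].
    + intros z Hz; destruct (Hpsi z Hz) as [D B].
      repeat split; auto 6 with cdiff.
      apply contraction2_scal_row; [left; exact Hz | now apply Hmn].
    + exact E0.
    + change (0 * (n - Cconj m * psi 0) = 0)%C; ring.
    + change (0 * (b1 + Cconj b2 * psi 0) = 0)%C; ring.
    + destruct (Hmn (psi l)) as [_ Dt].
      cbv [entry mat2 coeff_mat mk_matrix mk_Tn Tn fst snd]; simpl.
      f_equal; [f_equal; [exact E2 | now rewrite E1]|].
      apply (f_equal (Cmult l)) in Dt; rewrite E3, <- Dt; ring.
Qed.

(** * The equivalence *)

Lemma ForallPairs_iff_of_all_iff (Q : Prop) (L : list Prop) :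
  (forall P, In P L -> (P <-> Q)) -> ForallPairs iff L.
Proof. intros H P P' HP HP'; rewrite (H P HP), (H P' HP'); reflexivity. Qed.

Theorem theorem1p1 (lambda0 a b p : C)
  (hlambda0 : unit_disc lambda0) (hlambda0_neq0 : lambda0 <> 0%C)
  (hx : tetrablock (a, b, p)) :
  ForallPairs iff
  [ (* (1) *)
    (exists phi : C -> C * C * C,
       analytic_on_disc phi /\ (forall z : C, unit_disc z -> closure tetrablock (phi z)) /\
       phi 0%C = (RtoC 0, RtoC 0, RtoC 0) /\ phi lambda0 = (a, b, p));
    (* (1') *)
    (exists phi : C -> C * C * C,
       analytic_on_disc phi /\ (forall z : C, unit_disc z -> tetrablock (phi z)) /\
       phi 0%C = (RtoC 0, RtoC 0, RtoC 0) /\ phi lambda0 = (a, b, p));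
    (* (2) *)
    Rmax ((Cmod (a - Cconj b * p)%C + Cmod (a * b - p)%C) / (1 - Cmod b ^ 2))
         ((Cmod (b - Cconj a * p)%C + Cmod (a * b - p)%C) / (1 - Cmod a ^ 2))
      <= Cmod lambda0;
    (* (3) *)
    (Cmod b <= Cmod a /\
       (Cmod (a - Cconj b * p)%C + Cmod (a * b - p)%C) / (1 - Cmod b ^ 2)
         <= Cmod lambda0) \/
    (Cmod a <= Cmod b /\
       (Cmod (b - Cconj a * p)%C + Cmod (a * b - p)%C) / (1 - Cmod a ^ 2)
         <= Cmod lambda0);
    (* (4) *)
    (exists F : C -> @matrix C 2 2,
       schur_class F /\
       entry (F 0%C) 0 0 = 0%C /\ entry (F 0%C) 1 0 = 0%C /\ entry (F 0%C) 1 1 = 0%C /\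
       (a, b, p) =
         (entry (F lambda0) 0 0, entry (F lambda0) 1 1, det2 (F lambda0)));
    (* (5) *)
    (Cmod b <= Cmod a /\
       Rbar_le (Hinf_norm (fun z => Psi z (a, b, p))) (Cmod lambda0)) \/
    (Cmod a <= Cmod b /\
       Rbar_le (Hinf_norm (fun z => Upsilon z (a, b, p))) (Cmod lambda0));
    (* (6) *)
    (Cmod b <= Cmod a /\
       Cmod a ^ 2 - Cmod lambda0 ^ 2 * Cmod b ^ 2 + Cmod p ^ 2
         + 2 * Cmod (RtoC (Cmod lambda0 ^ 2)%R * b - Cconj a * p)%C
         <= Cmod lambda0 ^ 2) \/
    (Cmod a <= Cmod b /\
       Cmod b ^ 2 - Cmod lambda0 ^ 2 * Cmod a ^ 2 + Cmod p ^ 2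
         + 2 * Cmod (RtoC (Cmod lambda0 ^ 2)%R * a - Cconj b * p)%C
         <= Cmod lambda0 ^ 2);
    (* (7) *)
    (Cmod b <= Cmod a /\
       forall z w : C, unit_disc z -> unit_disc w ->
         (lambda0 - a * z - b * lambda0 * w + p * z * w)%C <> 0%C) \/
    (Cmod a <= Cmod b /\
       forall z w : C, unit_disc z -> unit_disc w ->
         (lambda0 - a * lambda0 * z - b * w + p * z * w)%C <> 0%C);
    (* (8) *)
    (Cmod b <= Cmod a /\
       Cmod lambda0 * Cmod (a - Cconj b * p)%C
         + Cmod (RtoC (Cmod lambda0 ^ 2)%R * b - Cconj a * p)%C + Cmod p ^ 2
         <= Cmod lambda0 ^ 2) \/
    (Cmod a <= Cmod b /\
       Cmod lambda0 * Cmod (b - Cconj a * p)%C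
         + Cmod (RtoC (Cmod lambda0 ^ 2)%R * a - Cconj b * p)%C + Cmod p ^ 2
         <= Cmod lambda0 ^ 2);
    (* (9) *)
    (Cmod b <= Cmod a /\ Cmod p <= Cmod lambda0 /\
       Cmod a ^ 2 + Cmod (lambda0 * b)%C ^ 2 - Cmod p ^ 2
         + 2 * Cmod lambda0 * Cmod (a * b - p)%C <= Cmod lambda0 ^ 2) \/
    (Cmod a <= Cmod b /\ Cmod p <= Cmod lambda0 /\
       Cmod b ^ 2 + Cmod (lambda0 * a)%C ^ 2 - Cmod p ^ 2
         + 2 * Cmod lambda0 * Cmod (a * b - p)%C <= Cmod lambda0 ^ 2);
    (* (10) *)
    (Cmod b <= Cmod a /\ Cmod p <= Cmod lambda0 /\
       exists beta1 beta2 : C, Cmod beta1 + Cmod beta2 <= 1 /\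
         a = (beta1 * lambda0 + Cconj beta2 * p)%C /\
         (b * lambda0)%C = (beta2 * lambda0 + Cconj beta1 * p)%C) \/
    (Cmod a <= Cmod b /\ Cmod p <= Cmod lambda0 /\
       exists beta1 beta2 : C, Cmod beta1 + Cmod beta2 <= 1 /\
         (a * lambda0)%C = (beta1 * lambda0 + Cconj beta2 * p)%C /\
         b = (beta2 * lambda0 + Cconj beta1 * p)%C)
  ].
Proof.
  assert (Hb : Cmod b < 1) by exact (tetrablock_Cmod_lt_1 _ _ _ hx).
  assert (Ha : Cmod a < 1) by exact (tetrablock_Cmod_lt_1 _ _ _ (tetrablock_swap _ _ _ hx)).
  set (Q := (Cmod b <= Cmod a /\ Psi_le lambda0 a b p) \/
            (Cmod a <= Cmod b /\ Psi_le lambda0 b a p)).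
  assert (Q_of_both : Psi_le lambda0 a b p /\ Psi_le lambda0 b a p -> Q).
  { intros [H1 H2]; destruct (Rle_dec (Cmod b) (Cmod a)); [now left | right; split; auto; lra]. }
  assert (E1' : Q -> exists phi : C -> C * C * C,
    analytic_on_disc phi /\ (forall z : C, unit_disc z -> tetrablock (phi z)) /\
    phi 0%C = (RtoC 0, RtoC 0, RtoC 0) /\ phi lambda0 = (a, b, p)).
  { intros [[L H]|[L H]].
    - destruct (exists_tetrablock_map lambda0 a b p) as
        (f1 & f2 & f3 & Hf & F1 & F2 & F3 & G1 & G2 & G3); auto.
      exists (fun z => (f1 z, f2 z, f3 z)); rewrite F1, F2, F3, G1, G2, G3; repeat split.
      + intros z Hz; apply ex_derive_triple_iff; destruct (Hf z Hz) as (? & ? & ? & ?); auto.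
      + intros z Hz; now apply Hf.
    - destruct (exists_tetrablock_map lambda0 b a p) as
        (f1 & f2 & f3 & Hf & F1 & F2 & F3 & G1 & G2 & G3); auto.
      exists (fun z => (f2 z, f1 z, f3 z)); rewrite F1, F2, F3, G1, G2, G3; repeat split.
      + intros z Hz; apply ex_derive_triple_iff; destruct (Hf z Hz) as (? & ? & ? & ?); auto.
      + intros z Hz; apply tetrablock_swap; now apply Hf. }
  assert (Q_of_1 : (exists phi : C -> C * C * C,
    analytic_on_disc phi /\ (forall z : C, unit_disc z -> closure tetrablock (phi z)) /\
    phi 0%C = (RtoC 0, RtoC 0, RtoC 0) /\ phi lambda0 = (a, b, p)) ->
    Psi_le lambda0 a b p /\ Psi_le lambda0 b a p).
  { intros (phi & H1 & H2 & H3 & H4); exact (Psi_le_of_closure_valued phi _ _ _ _ hlambda0 H1 H2 H3 H4). }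
  assert (Cl : (exists phi : C -> C * C * C,
    analytic_on_disc phi /\ (forall z : C, unit_disc z -> tetrablock (phi z)) /\
    phi 0%C = (RtoC 0, RtoC 0, RtoC 0) /\ phi lambda0 = (a, b, p)) ->
    exists phi : C -> C * C * C,
    analytic_on_disc phi /\ (forall z : C, unit_disc z -> closure tetrablock (phi z)) /\
    phi 0%C = (RtoC 0, RtoC 0, RtoC 0) /\ phi lambda0 = (a, b, p)).
  { intros (phi & H1 & H2 & H3 & H4); exists phi; repeat split; auto.
    intros z Hz V HV; exists (phi z); split; [now apply locally_singleton | auto]. }
  apply (ForallPairs_iff_of_all_iff Q).
  intros P HP; repeat destruct HP as [<-|HP]; [..|destruct HP].
  - split; auto.
  - split; auto.
  - rewrite (Cmult_comm a b) at 2; split.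
    + intros H; apply Q_of_both; split; apply Psi_le_iff_3; auto.
      * eapply Rle_trans; [apply Rmax_l | exact H].
      * eapply Rle_trans; [apply Rmax_r | exact H].
    (* [Q] contains only one of the two inequalities; the other is recovered by building the map and
       applying Schwarz's lemma to it. *)
    + intros H; destruct (Q_of_1 (Cl (E1' H))).
      apply Rmax_lub; apply Psi_le_iff_3; auto.
  - unfold Q; rewrite (Psi_le_iff_3 lambda0 a b p), (Psi_le_iff_3 lambda0 b a p),
      (Cmult_comm b a) by auto; reflexivity.
  - split.
    + intros (F & HF & H00 & H10 & H11 & E); injection E as Ea Eb Ep; apply Q_of_both.
      rewrite Ea, Eb, Ep; now apply Psi_le_of_schur.
    + intros [[L H]|[L H]].
      * now apply (exists_schur lambda0 a b p).
      * now apply (exists_schur lambda0 b a p).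
  - unfold Q; rewrite (Psi_le_iff_5 lambda0 a b p), (Psi_le_iff_5 lambda0 b a p) by auto;
      reflexivity.
  - unfold Q; rewrite (Psi_le_iff_6 lambda0 a b p), (Psi_le_iff_6 lambda0 b a p) by auto;
      reflexivity.
  - assert (Sw : (forall z w : C, unit_disc z -> unit_disc w ->
        (lambda0 - a * lambda0 * z - b * w + p * z * w)%C <> 0%C) <->
      (forall z w : C, unit_disc z -> unit_disc w ->
        (lambda0 - b * z - a * lambda0 * w + p * z * w)%C <> 0%C)).
    { split; intros H z w Hz Hw E; apply (H w z Hw Hz); rewrite <- E; ring. }
    unfold Q; rewrite Sw, (Psi_le_iff_7 lambda0 a b p), (Psi_le_iff_7 lambda0 b a p) by auto;
      reflexivity.
  - unfold Q; rewrite (Psi_le_iff_8 lambda0 a b p), (Psi_le_iff_8 lambda0 b a p) by auto;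
      reflexivity.
  - unfold Q; rewrite (Psi_le_iff_9 lambda0 a b p), (Psi_le_iff_9 lambda0 b a p),
      (Cmult_comm b a) by auto; reflexivity.
  - unfold Q; rewrite (Psi_le_iff_10 lambda0 a b p), (Psi_le_iff_10 lambda0 b a p) by auto.
    assert (Sw : (exists beta1 beta2 : C, Cmod beta1 + Cmod beta2 <= 1 /\
        (a * lambda0)%C = (beta1 * lambda0 + Cconj beta2 * p)%C /\
        b = (beta2 * lambda0 + Cconj beta1 * p)%C) <->
      (exists beta1 beta2 : C, Cmod beta1 + Cmod beta2 <= 1 /\
        b = (beta1 * lambda0 + Cconj beta2 * p)%C /\
        (a * lambda0)%C = (beta2 * lambda0 + Cconj beta1 * p)%C)).
    { split; intros (b1 & b2 & H1 & H2 & H3); exists b2, b1; rewrite Rplus_comm; auto. }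
    rewrite Sw; reflexivity.
Qed.
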